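(* For every $n\in\mathbb N$ and every homeomorphism $\eta:[0,\infty)\to[0,\infty)$ there exists a homeomorphism $\eta':[0,\infty)\to[0,\infty)$, depending only on $n$ and $\eta$, such that the following holds. Let $(X,d)$ be a compact connected metric space, and suppose that $X$ also carries the structure of a smooth $n$-dimensional Riemannian manifold with Riemannian metric $g$ and induced distance $d_g$, such that the identity map $(X,d)\to(X,d_g)$ is an $\eta$-quasisymmetric homeomorphism. Then there exists a sequence $(X_i,d_i)_{i\in\mathbb N}$ of metric spaces such that: (1) $(X_i,d_i)$ converges to $(X,d)$ in the Gromov-Hausdorff distance as $i\to\infty$; (2) for each $i$, $(X_i,d_i)$ is locally isometric to a Riemannian manifold; (3) for each $i$, there is an $\eta'$-quasisymmetric homeomorphism $(X_i,d_i)\to(X,d_g)$.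
   Context: A homeomorphism $f:(Y,d_Y)\to(Z,d_Z)$ between metric spaces is $\eta$-quasisymmetric, for a homeomorphism $\eta:[0,\infty)\to[0,\infty)$, if $$d_Z(f(p),f(q))\le \eta\left(\frac{d_Y(p,q)}{d_Y(q,s)}\right)d_Z(f(q),f(s))$$ for all points $p,q,s\in Y$ with $s\ne q$. The distance $d_g$ induced by a Riemannian metric $g$ is the infimum of $g$-lengths of curves joining two points; a Riemannian manifold is regarded as a metric space with its induced distance. A metric space $Y$ is locally isometric to a metric space $Z$ if every point of $Y$ has an open neighborhood which, with the restricted metric, is isometric to an open subset of $Z$ with the restricted metric. The Hausdorff distance between subsets $A,B$ of a metric space is the infimum of $r\ge 0$ such that each of $A,B$ is contained in the open $r$-neighborhood of the other. The Gromov-Hausdorff distance between metric spaces $Y,Z$ is the infimum of the Hausdorff distances between $f(Y)$ and $h(Z)$ over all metric spaces $W$ and isometric embeddings $f:Y\to W$, $h:Z\to W$. *)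

(* Defs.v *)
From mathcomp Require Import all_boot all_order all_algebra.
From mathcomp Require Import all_classical all_reals all_analysis.

Set Implicit Arguments.
Unset Strict Implicit.
Unset Printing Implicit Defensive.

Import Order.TTheory GRing.Theory Num.Theory.
Import numFieldNormedType.Exports.

Local Open Scope classical_set_scope.
Local Open Scope ring_scope.

Definition inverse_homeos (T U : topologicalType) (A : set T) (B : set U)
    (f : T -> U) (h : U -> T) : Prop :=
  [/\ set_fun A B f /\ set_fun B A h,
      {in A, cancel f h} /\ {in B, cancel h f},
      {within A, continuous f} &
      {within B, continuous h}].

Definition homeo_half_line (R : realType) (eta : R -> R) : Prop :=
  exists theta : R -> R,
    inverse_homeos (`[0, +oo[ : set R) (`[0, +oo[ : set R) eta theta.

(** ** Metric notions

    These take the distance functions as arguments, because one carrier may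
    bear two distances, such as [mdist] and a Riemannian distance. *)

Section metric_notions.
Context {R : realType}.

Definition dist_continuous (Y Z : Type) (dY : Y -> Y -> R) (dZ : Z -> Z -> R)
    (f : Y -> Z) : Prop :=
  forall p (e : R), 0 < e -> exists2 r : R, 0 < r &
    forall q, dY p q < r -> dZ (f p) (f q) < e.

Definition dist_homeo (Y Z : Type) (dY : Y -> Y -> R) (dZ : Z -> Z -> R)
    (f : Y -> Z) : Prop :=
  exists h : Z -> Y,
    [/\ cancel f h, cancel h f, dist_continuous dY dZ f &
        dist_continuous dZ dY h].

Definition quasisymmetric_homeo (Y Z : Type)
    (dY : Y -> Y -> R) (dZ : Z -> Z -> R) (eta : R -> R) (f : Y -> Z) : Prop :=
  dist_homeo dY dZ f /\
  forall p q s : Y, s <> q ->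
    dZ (f p) (f q) <= eta (dY p q / dY q s) * dZ (f q) (f s).

Definition dist_open (Y : Type) (dY : Y -> Y -> R) (U : set Y) : Prop :=
  forall p, U p -> exists2 r : R, 0 < r & forall q, dY p q < r -> U q.

Definition locally_isometric (Y Z : Type)
    (dY : Y -> Y -> R) (dZ : Z -> Z -> R) : Prop :=
  forall y : Y, exists (U : set Y) (f : Y -> Z),
    [/\ U y, dist_open dY U, dist_open dZ (f @` U) &
        forall p q, U p -> U q -> dZ (f p) (f q) = dY p q].

Definition open_neighborhood (W : metricType R) (A : set W) (r : R) : set W :=
  [set w | exists2 a, A a & mdist a w < r].

(* Extended-real valued, so that the infimum of the empty set is [+oo]. *)
Definition hausdorff_dist (W : metricType R) (A B : set W) : \bar R :=
  ereal_inf [set r%:E | r in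
    [set r : R | [/\ 0 <= r, A `<=` open_neighborhood B r &
                     B `<=` open_neighborhood A r]]].

Definition isometric_embedding (Y W : metricType R) (f : Y -> W) : Prop :=
  forall p q, mdist (f p) (f q) = mdist p q.

Definition gromov_hausdorff_dist (Y Z : metricType R) : \bar R :=
  ereal_inf [set x : \bar R |
    exists (W : metricType R) (f : Y -> W) (h : Z -> W),
      [/\ isometric_embedding f, isometric_embedding h &
          x = hausdorff_dist (range f) (range h)]].

End metric_notions.

(** ** Smooth manifolds *)

Section smoothness.
Context {R : realType} {n : nat} {V : normedModType R}.

Fixpoint iter_partial (f : 'rV[R]_n -> V) (s : seq 'I_n) : 'rV[R]_n -> V :=
  if s is i :: s' then iter_partial (fun x => 'D_(delta_mx 0 i) f x) s' else f.

(* C^infinity on an open set [U]: the values of [f] outside [U] are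
   irrelevant. *)
Definition smooth_on (U : set 'rV[R]_n) (f : 'rV[R]_n -> V) : Prop :=
  forall (s : seq 'I_n) x, U x ->
    {for x, continuous (iter_partial f s)} /\
    forall i, derivable (iter_partial f s) x (delta_mx 0 i).

End smoothness.

(* [chart_map] and [chart_inv] are total functions, meaningful only on
   [chart_dom] and [chart_cod] respectively. *)
Record chart (R : realType) (n : nat) (M : topologicalType) := Chart {
  chart_dom : set M ;
  chart_cod : set 'rV[R]_n ;
  chart_map :> M -> 'rV[R]_n ;
  chart_inv : 'rV[R]_n -> M ;
  open_chart_dom : open chart_dom ;
  open_chart_cod : open chart_cod ;
  chart_homeo : inverse_homeos chart_dom chart_cod chart_map chart_inv }.

Definition transition (R : realType) (n : nat) (M : topologicalType)
  (c c' : chart R n M) : 'rV[R]_n -> 'rV[R]_n := c' \o chart_inv c.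

(* Without boundary, not necessarily connected. The field [chart_at] only
   selects a chart around each point; nothing below depends on the selection. *)
Record smooth_manifold (R : realType) (n : nat) (M : topologicalType) :=
  SmoothManifold {
  atlas : set (chart R n M) ;
  chart_at : M -> chart R n M ;
  chart_at_atlas : forall x, atlas (chart_at x) ;
  chart_at_dom : forall x, chart_dom (chart_at x) x ;
  smooth_transition : forall c c', atlas c -> atlas c' ->
    smooth_on (c @` (chart_dom c `&` chart_dom c')) (transition c c') ;
  manifold_hausdorff : hausdorff_space M ;
  manifold_second_countable : @second_countable M }.

(** ** Riemannian metrics and their distances *)

Definition bilin (R : realType) (n : nat) (A : 'M[R]_n) (v w : 'rV[R]_n) : R :=
  (v *m A *m w^T) 0 0.

(* [gram c x] is the matrix of the inner product on the tangent space at [x]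
   in the coordinate basis of the chart [c]; [gram_change] says that these
   matrices define one and the same inner product for all charts around [x]. *)
Record riemannian_metric (R : realType) (n : nat) (M : topologicalType)
    (S : smooth_manifold R n M) := RiemannianMetric {
  gram : chart R n M -> M -> 'M[R]_n ;
  gram_sym : forall c x, atlas S c -> chart_dom c x -> (gram c x)^T = gram c x ;
  gram_posdef : forall c x v, atlas S c -> chart_dom c x -> v != 0 ->
    0 < bilin (gram c x) v v ;
  gram_smooth : forall c, atlas S c ->
    smooth_on (chart_cod c) (gram c \o chart_inv c) ;
  gram_change : forall c c' x v w, atlas S c -> atlas S c' ->
    chart_dom c x -> chart_dom c' x ->
    bilin (gram c x) v w =
    bilin (gram c' x) ('D_v (transition c c') (c x))
                      ('D_w (transition c c') (c x)) }.

Section riemannian_distance.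
Context {R : realType} {n : nat} {M : topologicalType}
  {S : smooth_manifold R n M} (g : riemannian_metric S).

Definition velocity (gamma : R -> M) (t : R) : 'rV[R]_n :=
  derive1 (chart_at S (gamma t) \o gamma) t.

Definition speed (gamma : R -> M) (t : R) : R :=
  Num.sqrt (bilin (gram g (chart_at S (gamma t)) (gamma t))
                  (velocity gamma t) (velocity gamma t)).

Definition C1_at (gamma : R -> M) (t : R) : Prop :=
  let u := chart_at S (gamma t) \o gamma in
  [/\ {for t, continuous gamma},
      \forall s \near t, derivable u s 1 &
      {for t, continuous (derive1 u)}].

(* C^1 up to the endpoints: [gamma] agrees on [[a, b]] with a curve that is C^1
   in a neighborhood of [[a, b]]. *)
Definition C1_on (a b : R) (gamma : R -> M) : Prop :=
  exists sigma : R -> M, forall t, a <= t <= b ->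
    C1_at sigma t /\ gamma t = sigma t.

(* The sequence [0 :: rcons s 1] is a subdivision of [[0, 1]]. *)
Definition piecewise_C1 (gamma : R -> M) : Prop :=
  exists s : seq R, path <%R 0 (rcons s 1) /\
    forall i, (i <= size s)%N ->
      C1_on (nth 0 (0 :: rcons s 1) i) (nth 0 (0 :: rcons s 1) i.+1) gamma.

Definition curve_length (gamma : R -> M) : \bar R :=
  \int[lebesgue_measure]_(t in `[0, 1]) (speed gamma t)%:E.

(* Curves are parametrized by [[0, 1]]. The infimum is finite as soon as [x]
   and [y] lie in the same connected component. *)
Definition riemannian_dist (x y : M) : R :=
  fine (ereal_inf [set curve_length gamma | gamma in
    [set gamma : R -> M | [/\ piecewise_C1 gamma, gamma 0 = x & gamma 1 = y]]]).

End riemannian_distance.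

(* A Riemannian manifold is a metric space for its induced distance only when
   it is connected. The dimension is not prescribed. *)
Definition locally_isometric_to_riemannian (R : realType) (Y : metricType R) :
    Prop :=
  exists (m : nat) (M : topologicalType) (S : smooth_manifold R m M)
         (g : riemannian_metric S),
    connected [set: M] /\
    locally_isometric (@mdist R Y) (riemannian_dist g).

(* Main.v *)
(* Fix theta > 0 and let r(x) be the [d_g]-distance from x to some point at
   [d]-distance theta. By quasisymmetry r varies by a bounded factor over
   [d]-balls of radius 2 theta, so averaging theta / r over such balls with bump
   functions gives a smooth kappa comparable to theta / r. For a suitable
   multiple of kappa, the distance rho of kappa^2 g satisfies d <= rho + theta.
   It is much larger than d at large scales; allowing one jump along d at cost
   theta gives the distance
     d'(x, y) = min (rho x y, inf_(u, v) (rho x u + d u v + theta + rho v y)),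
   which is within theta of d and equals rho below theta, hence is locally
   Riemannian. Quasisymmetry of (X, d') -> (X, d_g) follows by comparing
   d'(p, q) and d'(q, s) with theta: below theta, d' is d_g / r up to constants
   and the factor theta, and above it d' is comparable to d. *)

(* The constants do not depend on theta because two units are used throughout: theta for d and r(q)
   for [d_g] near q. Quasisymmetry compares both [d_g(p, q)] and [d_g(q, s)] with r(q) through
   values of eta at ratios of d-distances, and r(q) then cancels.

   The multiple of kappa is fixed by asking that a curve leaving the d-ball of radius theta / 2 has
   rho-length at least theta. This yields the bound of d by rho + theta. The same bound explains why
   one jump is enough for a triangle inequality: two successive jumps merge into one, the second
   toll theta paying for the replacement of the rho-path between them by d.

   Curves are unconstrained outside their interval and their speed is not known to be measurable, so
   lengths are handled as lower integrals, and speeds are compared only off finitely many times. *)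
Require Import Defs.
From HB Require Import structures.
From mathcomp Require Import all_boot all_order all_algebra.
From mathcomp Require Import all_classical all_reals all_analysis.
From mathcomp Require Import measurable_realfun.
From mathcomp Require Import ring lra.

Set Implicit Arguments.
Unset Strict Implicit.
Unset Printing Implicit Defensive.

Import Order.TTheory GRing.Theory Num.Theory.
Import numFieldNormedType.Exports.

Local Open Scope classical_set_scope.
Local Open Scope ring_scope.

(* Measurability is not assumed: the integral of a nonnegative function is the
   supremum of the integrals of its simple minorants. *)
Section lower_integral.
Context {R : realType}.
Local Notation mu := (@lebesgue_measure R).
Implicit Types (D : set R) (f g : R -> R).
Local Open Scope ereal_scope.

Import HBNNSimple.

(** A simple function below the restriction of [f] to [D] vanishes off [D], so integrating it over
    [D] loses nothing. This reduces the estimates below to simple functions, which are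
    measurable. *)
Lemma integral_le_nnsfun D f (c : \bar R) : measurable D ->
  (forall x, 0 <= f x)%R ->
  (forall h : {nnsfun (measurableTypeR R) >-> R},
    (forall x, D x -> h x <= f x)%R -> \int[mu]_(x in D) (h x)%:E <= c) ->
  \int[mu]_(x in D) (f x)%:E <= c.
Proof.
move=> mD f0 hc; rewrite ge0_integralE; last by move=> x _; rewrite lee_fin.
apply: ge_ereal_sup => _ [h /= hf <-].
have hfD x : D x -> (h x <= f x)%R.
  by move=> Dx; have := hf x; rewrite patchE mem_set// lee_fin.
rewrite -integralT_nnsfun; apply: le_trans (hc h hfD).
rewrite [leRHS]integral_mkcond.
rewrite le_eqVlt; apply/orP; left; apply/eqP/eq_integral => x _.
rewrite patchE; case: ifPn => // xD; have := hf x; rewrite patchE (negbTE xD).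
by rewrite lee_fin => hx0; congr EFin; apply/eqP; rewrite eq_le hx0 fun_ge0.
Qed.

Lemma le_lower_integral D (f g : R -> \bar R) : (forall x, D x -> 0 <= f x) ->
  (forall x, D x -> f x <= g x) ->
  \int[mu]_(x in D) f x <= \int[mu]_(x in D) g x.
Proof.
move=> f0 fg; rewrite !ge0_integralE//; last first.
  by move=> x Dx; rewrite (le_trans (f0 x Dx)) ?fg.
apply: le_ereal_sup => _ [h /= hf <-]; exists h => //= x.
apply: le_trans (hf x) _; rewrite !patchE; case: ifPn => //.
by rewrite inE => /fg.
Qed.

(** The exceptional set is meant for breakpoints of curves. A simple minorant of [f], multiplied by
    the indicator of the complement of [N], keeps its integral and becomes a minorant of [g] on
    [D]. *)
Lemma le_lower_integral_finite D (N : set R) f g : measurable D ->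
  finite_set N -> (forall x, 0 <= f x)%R -> (forall x, 0 <= g x)%R ->
  (forall x, D x -> ~ N x -> f x <= g x)%R ->
  \int[mu]_(x in D) (f x)%:E <= \int[mu]_(x in D) (g x)%:E.
Proof.
move=> mD finN f0 g0 fg; apply: integral_le_nnsfun => // h hf.
have cN := finite_set_countable finN.
have mN : measurable (N : set (measurableTypeR R)) by exact: countable_measurable.
rewrite (@ae_eq_integral _ _ _ mu D (EFin \o (h \* \1_(~` N))%R)).
- apply: le_lower_integral => x Dx /=; rewrite lee_fin indicE.
    by rewrite mulr_ge0 ?fun_ge0.
  have [xN|xN] := pselect (N x).
    by rewrite memNset ?mulr0//; apply.
  by rewrite mem_set// mulr1 (le_trans (hf x Dx)) ?fg.
- by [].
- by apply/measurable_EFinP; exact: measurable_funTS.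
- apply/measurable_EFinP/measurable_funTS/measurable_funM => //.
  by apply: measurable_indic; exact: measurableC.
- exists N; split => //; first exact: countable_lebesgue_measure0.
  move=> x /= nx; apply: contrapT => Nx; apply: nx => Dx /=.
  by rewrite indicE mem_set ?mulr1.
Qed.

(** Only one inequality needs simple functions; the other is the same inequality for the factor
    [k^-1]. *)
Lemma lower_integralZ D f (k : R) : measurable D -> (0 < k)%R ->
  (forall x, 0 <= f x)%R ->
  \int[mu]_(x in D) (k * f x)%:E = k%:E * \int[mu]_(x in D) (f x)%:E.
Proof.
move=> mD.
have le g r : (0 < r)%R -> (forall x, 0 <= g x)%R ->
    \int[mu]_(x in D) (r * g x)%:E <= r%:E * \int[mu]_(x in D) (g x)%:E.
  move=> r0 g0; apply: integral_le_nnsfun => //.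
    by move=> x; rewrite mulr_ge0 ?g0 ?ltW.
  move=> h hg; rewrite (_ : (fun x => (h x)%:E) =
      (fun x => r%:E * (r^-1 * h x)%:E)); last first.
    by apply/funext => x; rewrite -EFinM mulrA mulfV ?mul1r// gt_eqF.
  rewrite ge0_integralZl_EFin//; first last.
  - exact: ltW.
  - apply/measurable_EFinP/measurable_funTS/measurable_funM => //.
  - by move=> x _; rewrite lee_fin mulr_ge0 ?fun_ge0// invr_ge0 ltW.
  apply: lee_wpmul2l; first by rewrite lee_fin ltW.
  apply: le_lower_integral => x Dx; rewrite lee_fin.
    by rewrite mulr_ge0 ?fun_ge0// invr_ge0 ltW.
  by rewrite mulrC ler_pdivrMr// mulrC hg.
move=> k0 f0; apply/eqP; rewrite eq_le le//=.
rewrite -lee_pdivlMl//.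
rewrite [X in X <= _](_ : _ = \int[mu]_(x in D) (k^-1 * (k * f x))%:E).
  by apply: le; rewrite ?invr_gt0// => x; rewrite mulr_ge0// ltW.
by apply: eq_integral => x _; rewrite mulKf// gt_eqF.
Qed.

(** For simple functions this is additivity of the measure. A minorant on [[a, c]] restricts to both
    halves, and conversely minorants on the halves glue to one on [[a, c]]. *)
Lemma lower_integral_itvU f (a b c : R) : (a <= b)%R -> (b <= c)%R ->
  (forall x, 0 <= f x)%R ->
  \int[mu]_(x in `[a, c]) (f x)%:E =
  \int[mu]_(x in `[a, b]) (f x)%:E + \int[mu]_(x in `[b, c]) (f x)%:E.
Proof.
move=> ab bc f0.
have split (h : {nnsfun (measurableTypeR R) >-> R}) :
    \int[mu]_(x in `[a, c]) (h x)%:E =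
    \int[mu]_(x in `[a, b]) (h x)%:E + \int[mu]_(x in `[b, c]) (h x)%:E.
  have mh (D : set R) : measurable_fun (D : set (measurableTypeR R)) (fun x => (h x)%:E).
    by apply/measurable_EFinP; exact: measurable_funTS.
  rewrite -[X in _ = _ + X]integral_itv_obnd_cbnd//.
  rewrite -ge0_integral_setU//.
  - by rewrite -itv_bndbnd_setU// ?bnd_simp.
  - by move=> x _; rewrite lee_fin.
  - rewrite disj_set2E; apply/eqP/seteqP; split => // x [] /=.
    rewrite !in_itv/= => /andP[_ xb] /andP[bx _].
    by have := lt_le_trans bx xb; rewrite ltxx.
  - exact: mh.
have pos D : 0 <= \int[mu]_(x in D) (f x)%:E.
  by apply: integral_ge0 => x _; rewrite lee_fin.
apply/le_anti/andP; split.
  apply: integral_le_nnsfun => // h hf; rewrite split; apply: leeD.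
  - apply: le_lower_integral => x; rewrite ?lee_fin//= in_itv/= => /andP[ax xb].
    by apply: hf; rewrite /= in_itv/= ax (le_trans xb bc).
  - apply: le_lower_integral => x; rewrite ?lee_fin//= in_itv/= => /andP[bx xc].
    by apply: hf; rewrite /= in_itv/= xc (le_trans ab bx).
(* The infinite case is set aside so that the integrals over subintervals are finite and can be
   subtracted. *)
have [->|] := eqVneq (\int[mu]_(x in `[a, c]) (f x)%:E) +oo; first exact: leey.
rewrite -ltey => Lfin.
have fin (D : set R) : D `<=` `[a, c] ->
    \int[mu]_(x in D) (f x)%:E \is a fin_num.
  move=> Dac; rewrite ge0_fin_numE//; apply: le_lt_trans Lfin.
  rewrite integral_mkcond [leRHS]integral_mkcond; apply: le_lower_integral => x _.
    by apply: erestrict_ge0 => y _; rewrite lee_fin.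
  rewrite !patchE; case: ifPn => xD; first by rewrite (mem_set (Dac x (set_mem xD))).
  by case: ifPn; rewrite ?lee_fin.
have fin2 : \int[mu]_(x in `[b, c]) (f x)%:E \is a fin_num.
  by apply: fin => x /=; rewrite !in_itv/= => /andP[/(le_trans ab)-> ->].
rewrite -leeBrDr//; apply: integral_le_nnsfun => // h hf.
have hfin : \int[mu]_(x in `[a, b]) (h x)%:E \is a fin_num.
  have := fin `[a, b]%classic; rewrite !ge0_fin_numE//.
    move=> {}fin; apply: le_lt_trans (fin _); last first.
      by move=> x /=; rewrite !in_itv/= => /andP[->] /le_trans -> //.
    by apply: le_lower_integral => x xab; rewrite lee_fin ?hf.
  by apply: integral_ge0 => x _; rewrite lee_fin.
rewrite leeBrDr// addeC -leeBrDr//; apply: integral_le_nnsfun => // h' h'f.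
rewrite leeBrDr// addeC.
(* The second indicator is half-open, so that the two minorants are not added at [b]. *)
pose k x := (h x * \1_(`[a, b]) x + h' x * \1_(`]b, c]) x)%R.
have splitk : \int[mu]_(x in `[a, c]) (k x)%:E =
    \int[mu]_(x in `[a, b]) (k x)%:E + \int[mu]_(x in `[b, c]) (k x)%:E.
  exact: (split (add_nnsfun (proj_nnsfun h (measurable_itv `[a, b]))
    (proj_nnsfun h' (measurable_itv `]b, c])))).
have k0 x : (0 <= k x)%R by rewrite addr_ge0// mulr_ge0 ?fun_ge0.
have mk (D : set R) : measurable_fun (D : set (measurableTypeR R)) (fun x => (k x)%:E).
  by apply/measurable_EFinP/measurable_funTS/measurable_funD;
    apply: measurable_funM => //; exact: measurable_indic.
have kf x : `[a, c]%classic x -> (k x <= f x)%R.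
  rewrite /= in_itv/= => /andP[ax xc]; rewrite /k !indicE.
  have [xb|bx] := leP x b.
    rewrite mem_set/= ?in_itv/= ?ax// mulr1 memNset ?mulr0 ?addr0.
      by apply: hf; rewrite /= in_itv/= ax.
    by rewrite /= in_itv/= ltNge xb.
  rewrite memNset/= ?in_itv/= ?ax ?[(x <= b)%R]leNgt ?bx// mulr0 add0r mem_set.
    by rewrite mulr1; apply: h'f; rewrite /= in_itv/= xc ltW.
  by rewrite /= in_itv/= bx.
rewrite [leLHS](_ : _ = \int[mu]_(x in `[a, c]) (k x)%:E).
  by apply: le_lower_integral => x xac; rewrite lee_fin ?kf.
rewrite splitk; congr (_ + _).
  apply: eq_integral => x; rewrite inE => xab; rewrite /k !indicE mem_set// mulr1.
  rewrite memNset ?mulr0 ?addr0// => /=; move: xab => /=.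
  by rewrite !in_itv/= => /andP[_ xb] /andP[]; rewrite ltNge xb.
have mh' (D : set R) : measurable_fun (D : set (measurableTypeR R))
    (fun x => (h' x)%:E).
  by apply/measurable_EFinP; exact: measurable_funTS.
rewrite -[LHS]integral_itv_obnd_cbnd; last exact: mh'.
rewrite -[RHS]integral_itv_obnd_cbnd; last exact: mk.
apply: eq_integral => x; rewrite inE => xbc.
rewrite /k !indicE (mem_set xbc) mulr1 memNset ?mulr0 ?add0r//=.
by move: xbc; rewrite /= !in_itv/= => /andP[bx _]; rewrite [(x <= b)%R]leNgt bx andbF.
Qed.

(** The pushforward by the inverse affine map, scaled by the inverse of the absolute value of [c],
    has the right value on half-open intervals, which characterizes Lebesgue measure. For negative
    [c] the preimage of such an interval is half-open on the other side. *)
Lemma lebesgue_measure_affine (c d : R) (A : set R) : (c != 0)%R ->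
  measurable (A : set (measurableTypeR R)) ->
  mu ((fun u => (u - d) / c)%R @^-1` A) = `|c|%:E * mu A.
Proof.
move=> c0 mA.
pose phi := (fun u => (u - d) / c)%R : measurableTypeR R -> measurableTypeR R.
have mphi : measurable_fun setT phi.
  apply: measurable_funM => //; exact: measurable_funB.
have cV : (0 <= `|c|^-1)%R by rewrite invr_ge0.
pose pm := measure_function_pushforward__canonical__measure_function_Measure mu mphi.
have -> : mu A = mscale (NngNum cV) pm A.
  apply: lebesgue_measure_unique => // _ [[x y] _ <-].
  rewrite lebesgue_measure_itv/= lte_fin.
  rewrite -[RHS]/(`|c|^-1%:E * mu (phi @^-1` `]x, y]%classic)).
  have [c1|c1] := ltP 0%R c.
    rewrite (_ : phi @^-1` _ = `](c * x + d)%R, (c * y + d)%R]%classic).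
      rewrite lebesgue_measure_itv/= lte_fin ltrD2r ltr_pM2l//.
      case: ifPn => _; last by rewrite mule0.
      rewrite -!EFinB -EFinM gtr0_norm//; congr EFin.
      by rewrite opprD addrACA subrr addr0 -mulrBr mulKf.
    apply/seteqP; split => u /=; rewrite !in_itv/= /phi ltr_pdivlMr// ler_pdivrMr//.
      by rewrite ltrBrDr lerBlDr ![(_ * c)%R]mulrC.
    by rewrite ltrBrDr lerBlDr ![(_ * c)%R]mulrC.
  have {c1} c1 : (c < 0)%R by rewrite lt_neqAle c0.
  rewrite (_ : phi @^-1` _ = `[(c * y + d)%R, (c * x + d)%R[%classic).
    rewrite lebesgue_measure_itv/= lte_fin ltrD2r ltr_nM2l//.
    case: ifPn => _; last by rewrite mule0.
    rewrite -!EFinB -EFinM ltr0_norm//; congr EFin.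
    rewrite opprD addrACA subrr addr0 -mulrBr -(opprB y x) mulrN invrN mulrNN.
    by rewrite mulKf.
  apply/seteqP; split => u /=; rewrite !in_itv/= /phi ltr_ndivlMr// ler_ndivrMr//.
    by rewrite ltrBlDr lerBrDr ![(_ * c)%R]mulrC andbC.
  by rewrite ltrBlDr lerBrDr ![(_ * c)%R]mulrC andbC.
rewrite -[X in _ = _ * X]/(`|c|^-1%:E * mu (phi @^-1` A)).
by rewrite muleA -EFinM mulfV ?mul1e// normr_eq0.
Qed.

(** Only an inequality, because [E] need only contain the image of [D]. The change of variables is
    made for a simple minorant, since [f] may fail to be measurable. *)
Lemma lower_integral_affine f (c d : R) (D E : set R) : (c != 0)%R ->
  measurable (D : set (measurableTypeR R)) ->
  measurable (E : set (measurableTypeR R)) -> (forall x, 0 <= f x)%R ->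
  (forall x, D x -> E (c * x + d)%R) ->
  \int[mu]_(x in D) (`|c| * f (c * x + d))%:E <= \int[mu]_(x in E) (f x)%:E.
Proof.
move=> c0 mD mE f0 DE; apply: integral_le_nnsfun => //.
  by move=> x; rewrite mulr_ge0.
move=> h hf.
pose phi := (fun u => (u - d) / c)%R : measurableTypeR R -> measurableTypeR R.
have mphi : measurable_fun setT phi.
  apply: measurable_funM => //; exact: measurable_funB.
have cV : (0 <= `|c|^-1)%R by rewrite invr_ge0.
have mh (S : set (measurableTypeR R)) : measurable_fun S (fun x => (h x)%:E).
  by apply/measurable_EFinP; exact: measurable_funTS.
pose pm := measure_function_pushforward__canonical__measure_function_Measure mu mphi.
rewrite (@eq_measure_integral _ _ _ _ (mscale (NngNum cV) pm)); last first.
  move=> A mA _; rewrite -[RHS]/(`|c|^-1%:E * mu (phi @^-1` A)).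
  rewrite lebesgue_measure_affine//.
  by rewrite muleA -EFinM mulVf ?mul1e// normr_eq0.
rewrite ge0_integral_mscale; [|by []|exact: mh|by move=> x _; rewrite lee_fin].
rewrite ge0_integral_pushforward; [|by []|by []|exact: mh|].
  rewrite lee_pdivrMl ?normr_gt0// -lower_integralZ ?normr_gt0//.
  rewrite integral_mkcond [leRHS]integral_mkcond.
  apply: le_lower_integral => u _.
    by apply: erestrict_ge0 => y _ /=; rewrite lee_fin.
  rewrite !patchE; case: ifPn => [|_]; last first.
    by case: ifPn => // _; rewrite lee_fin mulr_ge0.
  rewrite inE /preimage/= => uD.
  have phiK : (c * phi u + d = u)%R by rewrite /phi mulrC divfK// subrK.
  by have := DE _ uD; rewrite phiK => uE; rewrite mem_set// lee_fin -{2}phiK hf.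
by move=> x _; rewrite lee_fin.
Qed.

End lower_integral.

(** * Piecewise C^1 curves and their affine reparametrizations *)

Lemma is_derive_affine {R : realType} {V : normedModType R} (u : R -> V)
    (c d t : R) : derivable u (c * t + d) 1 ->
  is_derive t 1 (fun s => u (c * s + d)) (c *: derive1 u (c * t + d)).
Proof.
move=> du.
have dphi : is_derive t (1 : R) (fun s : R => c * s + d : R) c.
  apply: is_derive_eq; rewrite addr0 /GRing.scale/= mulr1//.
have /derivable1_diffP dphi1 : derivable (fun s : R => c * s + d : R) t 1 by [].
have /derivable1_diffP du1 := du.
have dcomp : differentiable (u \o (fun s : R => c * s + d : R)) t.
  exact: differentiable_comp.
split; first exact/derivable1_diffP.
rewrite -derive1E derive1E'// diff_comp//= -derive1E'// derive1E derive_val.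
by rewrite deriv1E//= -derive1E.
Qed.

Section piecewise_curves.
Context {R : realType} {n : nat} {M : topologicalType}
  {S : smooth_manifold R n M}.
Implicit Types (gamma sigma : R -> M) (a b c : R).

(** An inductive form of [piecewise_C1] over an arbitrary interval: restriction, concatenation and
    reparametrization become inductions on the pieces, without indices in a sequence. *)
Inductive pwC1 gamma : R -> R -> Prop :=
| pwC1_one a c : a < c -> @C1_on _ _ _ S a c gamma -> pwC1 gamma a c
| pwC1_cons a b c : a < b -> @C1_on _ _ _ S a b gamma -> pwC1 gamma b c ->
    pwC1 gamma a c.

Lemma pwC1P gamma a c : pwC1 gamma a c <->
  exists s : seq R, path <%R a (rcons s c) /\
    forall i, (i <= size s)%N ->
      @C1_on _ _ _ S (nth 0 (a :: rcons s c) i) (nth 0 (a :: rcons s c) i.+1)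
        gamma.
Proof.
split=> [|[s]].
  elim=> {a c} [a c ac H|a b c ab H _ [s [ps Hs]]].
    exists [::]; split=> /=; first by rewrite ac.
    by case.
  exists (b :: s); split => /=; first by rewrite ab.
  by case=> [|i]//= /Hs.
elim: s a => [|b s IH] a /= [/andP[ab ps] Hs].
  by apply: pwC1_one => //; have := Hs 0 isT.
apply: (@pwC1_cons _ _ b) => //; first by have := Hs 0 isT.
by apply: IH; split => // i si; exact: (Hs i.+1).
Qed.

Lemma pwC1_lt gamma a c : pwC1 gamma a c -> a < c.
Proof. by elim=> // {}a b {}c ab _ _; exact: lt_trans. Qed.

Lemma pwC1_cat gamma a b c : pwC1 gamma a b -> pwC1 gamma b c -> pwC1 gamma a c.
Proof.
move=> ab; elim: ab c => {a b} [a b ab H c|a b c ab H _ IH e] bc.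
  exact: (@pwC1_cons _ _ b).
by apply: (@pwC1_cons _ _ b) => //; exact: IH.
Qed.

Lemma C1_on_sub gamma a b a' b' : a <= a' -> b' <= b ->
  @C1_on _ _ _ S a b gamma -> @C1_on _ _ _ S a' b' gamma.
Proof.
move=> aa bb [sigma H]; exists sigma => t /andP[at_ tb]; apply: H.
by rewrite (le_trans aa at_) (le_trans tb bb).
Qed.

Lemma pwC1_left gamma a c s : pwC1 gamma a c -> a < s <= c -> pwC1 gamma a s.
Proof.
move=> H; elim: H s => {a c} [a c ac H|a b c ab H Hbc IH] s /andP[as_ sc].
  by apply: pwC1_one => //; exact: (C1_on_sub _ sc H).
have [sb|bs] := leP s b.
  by apply: pwC1_one => //; exact: (C1_on_sub _ sb H).
by apply: (pwC1_cons ab H); apply: IH; rewrite bs.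
Qed.

Lemma pwC1_right gamma a c s : pwC1 gamma a c -> a <= s < c -> pwC1 gamma s c.
Proof.
move=> H; elim: H s => {a c} [a c ac H|a b c ab H Hbc IH] s /andP[as_ sc].
  by apply: pwC1_one => //; exact: (C1_on_sub as_ _ H).
have [bs|sb] := leP b s; first by apply: IH; rewrite bs.
by apply: (pwC1_cons sb) => //; exact: (C1_on_sub as_ _ H).
Qed.

Lemma C1_on_ext gamma sigma a c : (forall t, a <= t <= c -> gamma t = sigma t) ->
  @C1_on _ _ _ S a c gamma -> @C1_on _ _ _ S a c sigma.
Proof. by move=> E [tau H]; exists tau => t act; rewrite -E//; exact: H. Qed.

Lemma pwC1_ext gamma sigma a c : (forall t, a <= t <= c -> gamma t = sigma t) ->
  pwC1 gamma a c -> pwC1 sigma a c.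
Proof.
move=> E H; elim: H E => {a c} [a c ac H|a b c ab H Hbc IH] E.
  by apply: pwC1_one => //; exact: (C1_on_ext E).
have bc := pwC1_lt Hbc.
apply: (pwC1_cons ab).
  by apply: (C1_on_ext _ H) => t /andP[at_ tb]; rewrite E// at_ (le_trans tb)// ltW.
by apply: IH => t /andP[bt tc]; apply: E; rewrite tc (le_trans _ bt)// ltW.
Qed.

Lemma pwC1_cst x a c : a < c -> pwC1 (cst x) a c.
Proof.
move=> ac; apply: pwC1_one => //; exists (cst x) => t _; split => //; rewrite /C1_at.
have -> : chart_at S (cst x t) \o cst x = cst (chart_at S x x :> 'rV[R]_n) by [].
split.
- exact: cst_continuous.
- by near=> s; exact: derivable_cst.
- rewrite (_ : derive1 _ = cst 0); first exact: cst_continuous.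
  by apply/funext => s; rewrite derive1_cst.
Unshelve. all: by end_near. Qed.

Lemma C1_at_affine sigma (c d t : R) : @C1_at _ _ _ S sigma (c * t + d) ->
  @C1_at _ _ _ S (fun s => sigma (c * s + d)) t.
Proof.
have cphi : {for t, continuous (fun s : R => c * s + d : R)}.
  by apply: cvgD; [apply: cvgM; [exact: cvg_cst|exact: cvg_id]|exact: cvg_cst].
move=> [ct dt dct]; split.
- exact: (@continuous_comp _ _ _ (fun s : R => c * s + d) sigma).
- have := cphi _ dt; rewrite !near_simpl; apply: filterS => s /=.
  by move=> /is_derive_affine[].
- have E : \forall s \near t,
      (fun s => c *: derive1 (chart_at S (sigma (c * t + d)) \o sigma) (c * s + d)) s =
      derive1 (chart_at S (sigma (c * t + d)) \o (fun s => sigma (c * s + d))) s.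
    have := cphi _ dt; rewrite !near_simpl; apply: filterS => s /=.
    by move=> /is_derive_affine[_ <-]; rewrite derive1E.
  apply: cvg_trans; first exact: near_eq_cvg E.
  rewrite -(nbhs_singleton E).
  apply: cvgZr.
  exact: (@continuous_comp _ _ _ (fun s : R => c * s + d)
    (derive1 (chart_at S (sigma (c * t + d)) \o sigma))).
Qed.

(** The [Num.min] and [Num.max] let one statement serve both orientations. *)
Lemma C1_on_affine gamma c d a b : 
  @C1_on _ _ _ S (Num.min (c * a + d) (c * b + d))
    (Num.max (c * a + d) (c * b + d)) gamma ->
  @C1_on _ _ _ S a b (fun s => gamma (c * s + d)).
Proof.
move=> [sigma H]; exists (fun s => sigma (c * s + d)) => t /andP[at_ tb].
have [|c1 E] := H (c * t + d); last by split; [exact: C1_at_affine|exact: E].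
have [c0|c0] := leP 0 c.
  by rewrite ge_min le_max !lerD2r (ler_wpM2l c0 at_) (ler_wpM2l c0 tb) orbT.
have c0' := ltW c0.
by rewrite ge_min le_max !lerD2r (ler_wnM2l c0' at_) (ler_wnM2l c0' tb) orbT.
Qed.

Lemma pwC1_affine_pos gamma c d a b : 0 < c ->
  pwC1 gamma (c * a + d) (c * b + d) -> pwC1 (fun s => gamma (c * s + d)) a b.
Proof.
move=> c0; move: (erefl (c * a + d)) (erefl (c * b + d)).
move: {1 3}(c * a + d) {1 3}(c * b + d) => a' b' ea eb H.
elim: H a b ea eb => {a' b'} [a' b' ab H|a' b' c' ab H Hbc IH] a b ea eb.
  have ab' : a < b by move: ab; rewrite ea eb ltrD2r ltr_pM2l.
  apply: pwC1_one => //; apply: C1_on_affine.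
  by rewrite -ea -eb min_l ?max_r ?ltW.
have eb' : b' = c * ((b' - d) / c) + d by rewrite mulrC divfK ?gt_eqF// subrK.
apply: (@pwC1_cons _ _ ((b' - d) / c)).
- by rewrite ltr_pdivlMr// ltrBrDr mulrC -ea.
- by apply: C1_on_affine; rewrite -eb' -ea min_l ?max_r ?ltW.
- exact: IH.
Qed.

Lemma pwC1_affine_neg gamma c d a b : c < 0 ->
  pwC1 gamma (c * b + d) (c * a + d) -> pwC1 (fun s => gamma (c * s + d)) a b.
Proof.
move=> c0; move: (erefl (c * a + d)) (erefl (c * b + d)).
move: {1 3}(c * a + d) {1 3}(c * b + d) => a' b' ea eb H.
elim: H a b ea eb => {a' b'} [a' b' ab H|a' b' c' ab H Hbc IH] a b ea eb.
  have ab' : a < b by move: ab; rewrite ea eb ltrD2r ltr_nM2l.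
  apply: pwC1_one => //; apply: C1_on_affine.
  by rewrite -ea -eb min_r ?max_l ?ltW.
have eb' : b' = c * ((b' - d) / c) + d by rewrite mulrC divfK ?lt_eqF// subrK.
(* Reversing the orientation sends the first piece of [gamma] to the end. *)
apply: (@pwC1_cat _ _ ((b' - d) / c)); first exact: IH.
apply: pwC1_one.
  by rewrite ltr_ndivrMr// ltrBrDr mulrC -eb.
by apply: C1_on_affine; rewrite -eb' -eb min_r ?max_l ?ltW.
Qed.

(** Inside a piece the curve agrees near [t] with its C^1 extension, so only endpoints of pieces are
    exceptional. This is what the chain rule for the speed needs. *)
Lemma pwC1_derivable gamma a c : pwC1 gamma a c -> exists2 N : set R,
  finite_set N & forall t, a <= t <= c -> ~ N t ->
    derivable (chart_at S (gamma t) \o gamma) t 1.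
Proof.
have one b e : @C1_on _ _ _ S b e gamma -> forall t, b < t < e ->
    derivable (chart_at S (gamma t) \o gamma) t 1.
  move=> [sigma H] t bte.
  have /andP[bt te] := bte.
  have [|[_ /nbhs_singleton ds _] E] := H t; first by rewrite !ltW.
  rewrite E; apply: (near_eq_derivable _ ds).
  near=> s; have : s \in `]b, e[ by near: s; exact: near_in_itvoo.
  rewrite in_itv/= => /andP[bs se].
  by have [|_ ->] := H s; first by rewrite !ltW.
elim=> {a c} [a c ac H|a b c ab H Hbc [N fN IH]].
  exists [set a; c]; first exact: finite_set2.
  move=> t /andP[at_ tc] Nt; apply: (one _ _ H).
  rewrite !lt_neqAle at_ tc !andbT; apply/andP; split; apply/eqP => E.
    by apply: Nt; left.
  by apply: Nt; right.
exists (N `|` [set a; b]); first by rewrite finite_setU; split => //; exact: finite_set2.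
move=> t /andP[at_ tc] Nt.
have [bt|tb] := leP b t.
  by apply: IH; [rewrite bt|apply: contra_not Nt; left].
apply: (one _ _ H); rewrite tb andbT lt_neqAle at_ andbT; apply/eqP => E.
by apply: Nt; right; left.
Unshelve. all: by end_near. Qed.

(** One-sided continuity is phrased through a function that is continuous at [t] and agrees with
    [gamma] on one side, because [gamma] is arbitrary outside [[a, c]] and each piece has its own
    extension. *)
Lemma pwC1_continuous_right gamma a c t : pwC1 gamma a c -> a <= t < c ->
  exists sigma b, [/\ t < b, b <= c, {for t, continuous sigma} &
    forall s, t <= s <= b -> gamma s = sigma s].
Proof.
elim=> {a c} [a c ac [sigma H]|a b c ab [sigma H] Hbc IH] /andP[at_ tc].
  exists sigma, c; split => //.
    by have [|[]] := H t; rewrite // at_ ltW.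
  by move=> s /andP[ts sc]; have [|] := H s; rewrite // sc (le_trans at_ ts).
have [bt|tb] := leP b t; first by apply: IH; rewrite bt.
exists sigma, b; split => //; first by rewrite ltW// (pwC1_lt Hbc).
  by have [|[]] := H t; rewrite // at_ ltW.
by move=> s /andP[ts sb]; have [|] := H s; rewrite // sb (le_trans at_ ts).
Qed.

Lemma pwC1_continuous_left gamma a c t : pwC1 gamma a c -> a < t <= c ->
  exists sigma b, [/\ b < t, a <= b, {for t, continuous sigma} &
    forall s, b <= s <= t -> gamma s = sigma s].
Proof.
elim=> {a c} [a c ac [sigma H]|a b c ab [sigma H] Hbc IH] /andP[at_ tc].
  exists sigma, a; split => //.
    by have [|[]] := H t; rewrite // tc ltW.
  by move=> s /andP[ts sc]; have [|] := H s; rewrite // ts (le_trans sc tc).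
have [tb|bt] := leP t b.
  exists sigma, a; split => //.
    by have [|[]] := H t; rewrite // tb ltW.
  by move=> s /andP[ts sc]; have [|] := H s; rewrite // ts (le_trans sc tb).
have [|tau [e [et be ctau E]]] := IH; first by rewrite bt.
by exists tau, e; split => //; rewrite (le_trans (ltW ab)).
Qed.

End piecewise_curves.

(** * Lengths of curves and the extended Riemannian distance *)

Section riemannian_edist.
Context {R : realType} {n : nat} {M : topologicalType}
  {S : smooth_manifold R n M} (g : riemannian_metric S).
Implicit Types (gamma sigma : R -> M) (a b c : R) (x y z : M).
Local Notation mu := (@lebesgue_measure R).

Lemma speed_ge0 gamma t : 0 <= speed g gamma t.
Proof. exact: sqrtr_ge0. Qed.

Lemma near_eq_speed gamma sigma t : {near t, gamma =1 sigma} ->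
  speed g gamma t = speed g sigma t.
Proof.
move=> E; have Et := nbhs_singleton E.
rewrite /speed /velocity Et !derive1E.
suff -> : 'D_1 (chart_at S (sigma t) \o gamma) t =
          'D_1 (chart_at S (sigma t) \o sigma) t by [].
apply: near_eq_derive; move: E; apply: filterS => s /= -> //.
Qed.

Lemma speed_cst x t : speed g (cst x) t = 0.
Proof.
rewrite /speed /velocity.
have -> : chart_at S (cst x t) \o cst x = cst (chart_at S x x :> 'rV[R]_n) by [].
by rewrite derive1_cst /bilin !mul0mx mxE sqrtr0.
Qed.

Lemma bilinZ (A : 'M[R]_n) (k : R) v :
  bilin A (k *: v) (k *: v) = k ^+ 2 * bilin A v v.
Proof.
by rewrite /bilin linearZ/= -!scalemxAl -scalemxAr scalerA mxE -expr2.
Qed.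

Lemma speed_affine gamma c d t :
  derivable (chart_at S (gamma (c * t + d)) \o gamma) (c * t + d) 1 ->
  speed g (fun s => gamma (c * s + d)) t = `|c| * speed g gamma (c * t + d).
Proof.
move=> /is_derive_affine[_ H]; rewrite /speed.
have -> : @velocity _ _ _ S (fun s => gamma (c * s + d)) t =
    c *: @velocity _ _ _ S gamma (c * t + d) by rewrite {1}/velocity derive1E.
by rewrite bilinZ sqrtrM ?sqr_ge0// sqrtr_sqr.
Qed.

Definition partial_length gamma a b : \bar R :=
  (\int[mu]_(t in `[a, b]) (speed g gamma t)%:E)%E.

Arguments partial_length gamma (a b)%_ring_scope.

(** The infimum before [fine] is applied: symmetry and the triangle inequality then hold without
    knowing that distances are finite. *)
Definition riemannian_edist x y : \bar R :=
  ereal_inf [set curve_length g gamma | gamma in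
    [set gamma : R -> M |
      [/\ @piecewise_C1 _ _ _ S gamma, gamma 0 = x & gamma 1 = y]]].

Local Notation edist := riemannian_edist.

Lemma partial_length_ge0 gamma a b : (0 <= partial_length gamma a b)%E.
Proof. by apply: integral_ge0 => t _; rewrite lee_fin speed_ge0. Qed.

Lemma partial_length_cat gamma a b c : a <= b -> b <= c ->
  partial_length gamma a c = (partial_length gamma a b + partial_length gamma b c)%E.
Proof. by move=> ab bc; apply: (lower_integral_itvU ab bc) => t; exact: speed_ge0. Qed.

Lemma riemannian_edist_ge0 x y : (0 <= edist x y)%E.
Proof. by apply: le_ereal_inf_tmp => _ [gamma _ <-]; exact: partial_length_ge0. Qed.

Lemma riemannian_edist_le gamma : @pwC1 _ _ _ S gamma 0 1 ->
  (edist (gamma 0%R) (gamma 1%R) <= partial_length gamma 0 1)%E.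
Proof.
move=> H; apply: ereal_inf_lbound; exists gamma => //; split => //.
exact/pwC1P.
Qed.

Lemma riemannian_edist_curve x y (e : \bar R) : (edist x y < e)%E ->
  exists gamma, [/\ @pwC1 _ _ _ S gamma 0 1, gamma 0 = x, gamma 1 = y &
    (partial_length gamma 0 1 < e)%E].
Proof.
move=> /ereal_inf_lt[_ [gamma [/pwC1P pg g0 g1] <-] lt].
by exists gamma; split.
Qed.

Lemma riemannian_edistxx x : edist x x = 0%E.
Proof.
apply/eqP; rewrite eq_le riemannian_edist_ge0 andbT.
have := @riemannian_edist_le (cst x) (pwC1_cst x ltr01).
rewrite [partial_length _ _ _](_ : _ = 0%E)// /partial_length.
by under eq_integral do rewrite speed_cst; rewrite integral0.
Qed.

(** The endpoints are left out because the derivative there sees the curves outside [[a, b]]; two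
    points do not change the integral. *)
Lemma partial_length_ext gamma sigma a b :
  (forall t, a < t < b -> speed g gamma t <= speed g sigma t) ->
  (partial_length gamma a b <= partial_length sigma a b)%E.
Proof.
move=> E; apply: (@le_lower_integral_finite _ _ [set a; b]).
- exact: measurable_itv.
- exact: finite_set2.
- by move=> t; exact: speed_ge0.
- by move=> t; exact: speed_ge0.
- move=> t /=; rewrite in_itv/= => /andP[at_ tb] Nt; apply: E.
  rewrite !lt_neqAle at_ tb !andbT; apply/andP; split; apply/eqP => tE.
    by apply: Nt; left.
  by apply: Nt; right.
Qed.

Lemma partial_length_stop gamma (x : M) a b :
  (forall t, a < t < b -> gamma t = x) -> partial_length gamma a b = 0%E.
Proof.
move=> E; apply/le_anti/andP; split; last exact: partial_length_ge0.
apply: (@le_trans _ _ (partial_length (cst x) a b)); last first.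
  by rewrite /partial_length; under eq_integral do rewrite speed_cst; rewrite integral0.
apply: partial_length_ext => t tab; rewrite (@near_eq_speed _ (cst x))//.
by near=> s; rewrite E//; have : s \in `]a, b[ by near: s; exact: near_in_itvoo.
Unshelve. all: by end_near. Qed.

Lemma eq_partial_length gamma sigma a b :
  (forall t, a < t < b -> gamma t = sigma t) ->
  (partial_length gamma a b <= partial_length sigma a b)%E.
Proof.
move=> E; apply: partial_length_ext => t tab; rewrite (@near_eq_speed _ sigma)//.
by near=> s; rewrite E//; have : s \in `]a, b[ by near: s; exact: near_in_itvoo.
Unshelve. all: by end_near. Qed.

(** Curves have to be parametrized by the unit interval. Instead of being rescaled, [gamma] is
    stopped at time [s]; the constant remainder has length 0. *)
Lemma riemannian_edist_initial gamma s : @pwC1 _ _ _ S gamma 0 1 -> 0 <= s <= 1 ->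
  (edist (gamma 0%R) (gamma s) <= partial_length gamma 0 s)%E.
Proof.
move=> H /andP[s0 s1].
have [->|sn0] := eqVneq s 0.
  by rewrite riemannian_edistxx partial_length_ge0.
have [->|sn1] := eqVneq s 1; first exact: riemannian_edist_le.
have {}s0 : 0 < s by rewrite lt_neqAle eq_sym sn0.
have {}s1 : s < 1 by rewrite lt_neqAle sn1.
pose sigma t := gamma (Num.min t s).
have E t : t <= s -> gamma t = sigma t by move=> ts; rewrite /sigma min_l.
have E' t : s <= t -> gamma s = sigma t by move=> ts; rewrite /sigma min_r.
have ps : @pwC1 _ _ _ S sigma 0 1.
  apply: (@pwC1_cat _ _ _ _ _ _ s).
    apply: (@pwC1_ext _ _ _ _ gamma); first by move=> t /andP[_ /E].
    by apply: (pwC1_left H); rewrite s0 ltW.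
  apply: (@pwC1_ext _ _ _ _ (cst (gamma s))); last exact: pwC1_cst.
  by move=> t /andP[/E' <-].
have := riemannian_edist_le ps.
rewrite -(E 0 (ltW s0)) -(E' 1 (ltW s1)) => /le_trans; apply.
rewrite (partial_length_cat sigma (ltW s0) (ltW s1)).
rewrite [X in (_ + X)%E](@partial_length_stop _ (gamma s)) ?adde0.
  by apply: eq_partial_length => t /andP[_ ts]; rewrite E// ltW.
by move=> t /andP[st _]; rewrite -E'// ltW.
Qed.

(** Mirror image of the preceding argument: the curve waits at [gamma s] until time [s]. *)
Lemma riemannian_edist_final gamma s : @pwC1 _ _ _ S gamma 0 1 -> 0 <= s <= 1 ->
  (edist (gamma s) (gamma 1%R) <= partial_length gamma s 1)%E.
Proof.
move=> H /andP[s0 s1].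
have [->|sn0] := eqVneq s 0; first exact: riemannian_edist_le.
have [->|sn1] := eqVneq s 1.
  by rewrite riemannian_edistxx partial_length_ge0.
have {}s0 : 0 < s by rewrite lt_neqAle eq_sym sn0.
have {}s1 : s < 1 by rewrite lt_neqAle sn1.
pose sigma t := gamma (Num.max t s).
have E t : s <= t -> gamma t = sigma t by move=> ts; rewrite /sigma max_l.
have E' t : t <= s -> gamma s = sigma t by move=> ts; rewrite /sigma max_r.
have ps : @pwC1 _ _ _ S sigma 0 1.
  apply: (@pwC1_cat _ _ _ _ _ _ s); last first.
    apply: (@pwC1_ext _ _ _ _ gamma); first by move=> t /andP[/E].
    by apply: (pwC1_right H); rewrite s1 ltW.
  apply: (@pwC1_ext _ _ _ _ (cst (gamma s))); last exact: pwC1_cst.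
  by move=> t /andP[_ /E' <-].
have := riemannian_edist_le ps.
rewrite -(E' 0 (ltW s0)) -(E 1 (ltW s1)) => /le_trans; apply.
rewrite (partial_length_cat sigma (ltW s0) (ltW s1)).
rewrite [X in (X + _)%E](@partial_length_stop _ (gamma s)) ?add0e.
  by apply: eq_partial_length => t /andP[st _]; rewrite E// ltW.
by move=> t /andP[_ ts]; rewrite -E'// ltW.
Qed.

Lemma partial_length_affine gamma (c d a b a' b' : R) : c != 0 ->
  @pwC1 _ _ _ S gamma a' b' ->
  (forall t, a <= t <= b -> a' <= c * t + d <= b') ->
  (partial_length (fun s => gamma (c * s + d)%R) a b <=
   partial_length gamma a' b')%E.
Proof.
move=> c0 /pwC1_derivable[N fN dN] sub.
apply: (@le_trans _ _
    (\int[mu]_(t in `[a, b]) (`|c| * speed g gamma (c * t + d))%:E)%E).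
  apply: (@le_lower_integral_finite _ _ ((fun t => c * t + d) @^-1` N)).
  - exact: measurable_itv.
  - apply: finite_preimage => // s t _ _ /addIr; exact: mulfI.
  - by move=> t; exact: speed_ge0.
  - by move=> t; rewrite mulr_ge0// speed_ge0.
  - move=> t /=; rewrite in_itv/= => /sub st Nt.
    by rewrite (speed_affine (dN _ st Nt)).
apply: (@lower_integral_affine _ (speed g gamma) c d _ _ c0).
- exact: measurable_itv.
- exact: measurable_itv.
- by move=> t; exact: speed_ge0.
- by move=> t /=; rewrite !in_itv/=; exact: sub.
Qed.

Lemma riemannian_edist_sym x y : edist x y = edist y x.
Proof.
suff H u v : (edist u v <= edist v u)%E by apply/le_anti; rewrite !H.
apply: le_ereal_inf_tmp => _ [gamma [/pwC1P pg g0 g1] <-].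
pose sigma t := gamma (-1 * t + 1).
have ps : @pwC1 _ _ _ S sigma 0 1.
  apply: pwC1_affine_neg; first by rewrite ltrN10.
  by rewrite mulr1 addNr mulr0 add0r.
have := riemannian_edist_le ps.
rewrite /sigma mulr0 add0r mulr1 addNr g0 g1 => /le_trans; apply.
apply: partial_length_affine => //.
by move=> t /andP[t0 t1]; rewrite mulN1r addrC subr_ge0 t1 gerBl.
Qed.

(** Two nearly minimal curves are run one after the other at double speed; the excess is split into
    two halves of [e]. *)
Lemma riemannian_edist_triangle y x z : (edist x z <= edist x y + edist y z)%E.
Proof.
have [->|xyoo] := eqVneq (edist x y) +oo%E.
  by rewrite addye ?leey// gt_eqF// (lt_le_trans _ (riemannian_edist_ge0 _ _)).
have [->|yzoo] := eqVneq (edist y z) +oo%E.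
  by rewrite addey ?leey// gt_eqF// (lt_le_trans _ (riemannian_edist_ge0 _ _)).
have fxy : edist x y \is a fin_num.
  by rewrite ge0_fin_numE ?riemannian_edist_ge0// ltey.
have fyz : edist y z \is a fin_num.
  by rewrite ge0_fin_numE ?riemannian_edist_ge0// ltey.
apply/lee_addgt0Pr => e e0.
have e2 : 0 < e / 2 by rewrite divr_gt0.
have [gamma [pg g0 g1 glt]] : exists gamma, [/\ @pwC1 _ _ _ S gamma 0 1,
    gamma 0 = x, gamma 1 = y & (partial_length gamma 0 1 < edist x y + (e / 2)%:E)%E].
  by apply: riemannian_edist_curve; rewrite lteDl ?lte_fin.
have [sigma [ps s0 s1 slt]] : exists gamma, [/\ @pwC1 _ _ _ S gamma 0 1,
    gamma 0 = y, gamma 1 = z & (partial_length gamma 0 1 < edist y z + (e / 2)%:E)%E].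
  by apply: riemannian_edist_curve; rewrite lteDl ?lte_fin.
pose tau t := if t <= 2^-1 then gamma (2 * t + 0) else sigma (2 * t + (- 1)).
have h1 : 2 * 2^-1 = 1 :> R by rewrite mulfV.
have h0 : 0 < 2^-1 :> R by rewrite invr_gt0.
have h2 : 2^-1 < 1 :> R by rewrite invf_lt1 ?ltr1n.
have E1 t : t <= 2^-1 -> gamma (2 * t + 0) = tau t by rewrite /tau => ->.
have E2 t : 2^-1 <= t -> sigma (2 * t + (- 1)) = tau t.
  rewrite le_eqVlt => /predU1P[<-|lt]; last by rewrite /tau leNgt lt.
  by rewrite /tau lexx h1 subrr addr0 s0 g1.
have pt : @pwC1 _ _ _ S tau 0 1.
  apply: (@pwC1_cat _ _ _ _ _ _ 2^-1).
    apply: (@pwC1_ext _ _ _ _ (fun t => gamma (2 * t + 0))).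
      by move=> t /andP[_ /E1].
    by apply: pwC1_affine_pos => //; rewrite mulr0 h1 !addr0.
  apply: (@pwC1_ext _ _ _ _ (fun t => sigma (2 * t + (- 1)))).
    by move=> t /andP[/E2].
  apply: pwC1_affine_pos => //; rewrite h1 subrr mulr1.
  by rewrite (_ : 2 + -1 = 1 :> R)//; ring.
have := riemannian_edist_le pt.
rewrite -(E1 0 (ltW h0)) -(E2 1 (ltW h2)) mulr0 addr0 mulr1 g0.
rewrite (_ : 2 + -1 = 1 :> R); last by ring.
rewrite s1 => /le_trans; apply.
rewrite (partial_length_cat tau (ltW h0) (ltW h2)).
have -> : (edist x y + edist y z + e%:E =
    (edist x y + (e / 2)%:E) + (edist y z + (e / 2)%:E))%E.
  by rewrite addeACA -EFinD -splitr.
apply: leeD.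
  apply: le_trans (ltW glt).
  apply: (@le_trans _ _ (partial_length (fun s => gamma (2 * s + 0)) 0 2^-1)).
    by apply: eq_partial_length => t /andP[_ th]; rewrite E1// ltW.
  apply: partial_length_affine => // t /andP[t0 th].
  by apply/andP; split; lra.
apply: le_trans (ltW slt).
apply: (@le_trans _ _ (partial_length (fun s => sigma (2 * s + (- 1))) 2^-1 1)).
  by apply: eq_partial_length => t /andP[th _]; rewrite E2// ltW.
apply: partial_length_affine => // t /andP[t0 th].
by apply/andP; split; lra.
Qed.

Lemma riemannian_distE x y : riemannian_dist g x y = fine (edist x y).
Proof. by []. Qed.

End riemannian_edist.

(** * First exit times and distances under a conformal change *)

(** The time [s] is the infimum of the times with [A <= u (gamma t)]. Continuity from the right puts
    [s] itself in this set, and continuity from the left excludes [A < u (gamma s)]. *)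
Lemma pwC1_exit {R : realType} {n : nat} {M : topologicalType}
    {S : smooth_manifold R n M} (gamma : R -> M) (u : M -> R) (A t1 : R) :
  @pwC1 _ _ _ S gamma 0 1 -> continuous u -> 0 <= t1 <= 1 ->
  u (gamma 0) < A -> A <= u (gamma t1) ->
  exists s, [/\ 0 < s <= 1, u (gamma s) = A &
    forall t, 0 <= t < s -> u (gamma t) < A].
Proof.
move=> pg cu t11 u0 u1.
pose E := [set t : R | 0 <= t <= 1 /\ A <= u (gamma t)].
have Et1 : E t1 by [].
have lbE : lbound E 0 by move=> t [/andP[]].
have hE : has_inf E by split; [exists t1|exists 0].
set s := inf E.
have s0 : 0 <= s by apply: lb_le_inf => //; exists t1.
have s1 : s <= 1.
  by have /andP[_ t1le] := t11; rewrite (le_trans (ge_inf _ Et1))//; exists 0.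
have below t : 0 <= t < s -> u (gamma t) < A.
  move=> /andP[t0 ts]; rewrite ltNge; apply/negP => uA.
  have : E t by split => //; rewrite t0 (le_trans (ltW ts)).
  by move=> /(ge_inf (proj2 hE)); rewrite leNgt ts.
have uA : A <= u (gamma s).
  rewrite leNgt; apply/negP => us.
  have sn1 : s < 1.
    rewrite lt_neqAle s1 andbT; apply/eqP => s1E.

    have : t1 < s \/ t1 = s.
      have /andP[_] := t11; rewrite -s1E le_eqVlt => /predU1P[->|]; first by right.
      by left.
    case=> [lt|t1s].
      by have := ge_inf (proj2 hE) Et1; rewrite leNgt lt.
    by move: u1; rewrite t1s leNgt us.
  have [|sigma [b [sb b1 csigma Eg]]] := @pwC1_continuous_right _ _ _ _ _ _ _ s pg.
    by rewrite s0.
  have Es : gamma s = sigma s by rewrite Eg// lexx ltW.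
  have cus : {for s, continuous (u \o sigma)} by apply: continuous_comp; [exact: csigma|exact: cu].
  have /nbhs_ballP[e /= e0 He] : \forall t \near s, u (sigma t) < A.
    by apply: (cvgr_lt (u (sigma s)) cus); rewrite -Es.
  pose d := Num.min e (b - s).
  have d0 : 0 < d by rewrite lt_min e0 subr_gt0.
  have de : d <= e by rewrite ge_min lexx.
  have db : d <= b - s by rewrite ge_min lexx orbT.
  have [t Et] := inf_adherent d0 hE; rewrite -/s => tlt.
  have st : s <= t by apply: ge_inf => //; exact: (proj2 hE).
  have tb : t <= b by lra.
  have te : t - s < e by lra.
  have := He t; rewrite /ball/= distrC ger0_norm ?subr_ge0// => /(_ te).
  have [_] := Et; rewrite Eg ?st//.
  by rewrite leNgt => /negP.
have sp : 0 < s.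
  by rewrite lt_neqAle s0 andbT; apply/eqP => s0E; move: uA; rewrite -s0E leNgt u0.
exists s; split; first by rewrite sp.
  apply/le_anti; rewrite uA andbT leNgt; apply/negP => Aus.
  have [|sigma [b [bs b0 csigma Eg]]] := @pwC1_continuous_left _ _ _ _ _ _ _ s pg.
    by rewrite sp.
  have Es : gamma s = sigma s by rewrite Eg// lexx ltW.
  have cus : {for s, continuous (u \o sigma)} by apply: continuous_comp; [exact: csigma|exact: cu].
  have /nbhs_ballP[e /= e0 He] : \forall t \near s, A < u (sigma t).
    by apply: (cvgr_gt (u (sigma s)) cus); rewrite -Es.
  pose d := Num.min (e / 2) (s - b).
  have d0 : 0 < d by rewrite lt_min divr_gt0// subr_gt0.
  have de : d < e.
    by rewrite gt_min; apply/orP; left; rewrite ltr_pdivrMr// ltr_pMr// ltr1n.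
  have db : d <= s - b by rewrite ge_min lexx orbT.
  have tb : b <= s - d by lra.
  have ts : s - d < s by rewrite gtrBl.
  have := below (s - d); rewrite ts (le_trans b0 tb) => /(_ isT).
  have := He (s - d); rewrite /ball/= opprD addrA subrr add0r opprK gtr0_norm//.
  move=> /(_ de); rewrite Eg ?tb ?ltW// => /lt_trans /[apply].
  by rewrite ltxx.
exact: below.
Qed.

Section conformal_change.
Context {R : realType} {n : nat} {M : topologicalType}
  {S : smooth_manifold R n M} (g g' : riemannian_metric S).
Implicit Types (x y z : M).
Local Notation edist := (riemannian_edist g).
Local Notation edist' := (riemannian_edist g').

(** A substitute for a point on a minimizing geodesic: a curve of length within [e] of the infimum
    must cross the level [u = A], and its two parts bound the two distances. *)
Lemma riemannian_edist_split (u : M -> R) (A e : R) x y : continuous u ->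
  u x < A -> A <= u y -> (edist x y < +oo)%E -> 0 < e ->
  exists2 z, u z = A & (edist x z + edist z y <= edist x y + e%:E)%E.
Proof.
move=> cu ux uy fin e0.
have [gamma [pg g0 g1 len]] : exists gamma, [/\ @pwC1 _ _ _ S gamma 0 1,
    gamma 0 = x, gamma 1 = y & (partial_length g gamma 0 1 < edist x y + e%:E)%E].
  apply: riemannian_edist_curve; rewrite lteDl ?lte_fin//.
  by rewrite ge0_fin_numE// riemannian_edist_ge0.
have [|||s [/andP[s0 s1] us _]] := @pwC1_exit _ _ _ _ gamma u A 1 pg cu.
- by rewrite ler01 lexx.
- by rewrite g0.
- by rewrite g1.
exists (gamma s) => //; apply: le_trans (ltW len).
rewrite (partial_length_cat g gamma (ltW s0) s1); apply: leeD.
  by rewrite -g0; apply: riemannian_edist_initial => //; rewrite (ltW s0).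
by rewrite -g1; apply: riemannian_edist_final => //; rewrite (ltW s0).
Qed.

Context (kappa : M -> R).
Hypothesis speedE : forall gamma t,
  speed g' gamma t = kappa (gamma t) * speed g gamma t.

(** Each curve is cut where it first reaches [u = A]. Up to there its speed grows by a factor at
    least [m], and its original length is at least [B], by [Bz] if it reaches the level and by [By]
    if it does not. *)
Lemma conformal_edist_ge (u : M -> R) (A m : R) (B : \bar R) x y :
  continuous u -> u x < A -> 0 < m -> (forall z, u z < A -> m <= kappa z) ->
  (B <= edist x y)%E -> (forall z, u z = A -> (B <= edist x z)%E) ->
  (m%:E * B <= edist' x y)%E.
Proof.
move=> cu ux m0 mk By Bz; apply: le_ereal_inf_tmp => _ [gamma [/pwC1P pg g0 g1] <-].
have bound s : 0 < s <= 1 -> (forall t, 0 <= t < s -> u (gamma t) < A) ->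
    (m%:E * edist x (gamma s) <= partial_length g' gamma 0 s)%E.
  move=> /andP[s0 s1] us.
  apply: (@le_trans _ _ (m%:E * partial_length g gamma 0 s)%E).
    apply: lee_wpmul2l; first by rewrite lee_fin ltW.
    by rewrite -g0; apply: riemannian_edist_initial => //; rewrite (ltW s0).
  rewrite /partial_length -lower_integralZ//; last first.
    by move=> t; exact: speed_ge0.
  (* The hypothesis on [u] covers only times before [s], so the time [s] is discarded. *)
  apply: (@le_lower_integral_finite _ _ [set s]).
  - exact: measurable_itv.
  - exact: finite_set1.
  - by move=> t; rewrite mulr_ge0 ?speed_ge0// ltW.
  - by move=> t; exact: speed_ge0.
  - move=> t /=; rewrite in_itv/= => /andP[t0 ts] tNs; rewrite speedE.
    apply: ler_wpM2r; first exact: speed_ge0.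
    by apply/mk/us; rewrite t0 lt_neqAle ts andbT; apply/eqP.
have [[t1 [t11 ut1]]|nex] := pselect (exists t, 0 <= t <= 1 /\ A <= u (gamma t)).
  have [|||s [s01 us Hs]] := @pwC1_exit _ _ _ _ gamma u A t1 pg cu => //.
    by rewrite g0.
  have /andP[s0 s1] := s01.
  apply: (@le_trans _ _ (partial_length g' gamma 0 s)); last first.
    by rewrite [leRHS](partial_length_cat g' gamma (ltW s0) s1) leeDl// partial_length_ge0.
  apply: le_trans (bound _ s01 Hs); apply: lee_wpmul2l; first by rewrite lee_fin ltW.
  exact: Bz.
apply: (@le_trans _ _ (m%:E * edist x (gamma 1%R))%E).
  by rewrite g1; apply: lee_wpmul2l => //; rewrite lee_fin ltW.
apply: bound; first by rewrite ltr01 lexx.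
move=> t /andP[t0 t1]; rewrite ltNge; apply/negP => uA; apply: nex.
by exists t; rewrite t0 ltW.
Qed.

(** A curve from [x] of length below [B] stays where [kappa <= K], and such curves suffice because
    [edist x y < B]. With [B] infinite the bound is global. *)
Lemma conformal_edist_le (K : R) (B : \bar R) x y : 0 < K ->
  (forall z, (edist x z < B)%E -> kappa z <= K) -> (edist x y < B)%E ->
  (edist' x y <= K%:E * edist x y)%E.
Proof.
move=> K0 kK yB.
have xyfin : edist x y \is a fin_num.
  by rewrite ge0_fin_numE ?riemannian_edist_ge0// (lt_le_trans yB) ?leey.
apply/lee_addgt0Pr => e e0.
have eK : 0 < e / K by rewrite divr_gt0.
have [gamma [pg g0 g1]] : exists gamma, [/\ @pwC1 _ _ _ S gamma 0 1,
    gamma 0 = x, gamma 1 = y & (partial_length g gamma 0 1 <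
      Order.min B (edist x y + (e / K)%:E))%E].
  by apply: riemannian_edist_curve; rewrite lt_min yB lteDl ?lte_fin.
rewrite lt_min => /andP[lenB lene].
apply: (@le_trans _ _ (K%:E * partial_length g gamma 0 1)%E); last first.
  rewrite (_ : K%:E * _ + _ = K%:E * (edist x y + (e / K)%:E))%E.
    by apply: lee_wpmul2l; [rewrite lee_fin ltW|exact: ltW].
  by rewrite muleDr ?fin_num_adde_defl// -EFinM mulrC divfK// gt_eqF.
rewrite -g0 -g1; apply: (le_trans (riemannian_edist_le g' pg)).
rewrite /partial_length -lower_integralZ//; last first.
  by move=> t; exact: speed_ge0.
apply: le_lower_integral => t; first by rewrite lee_fin speed_ge0.
rewrite /= in_itv/= => /andP[t0 t1]; rewrite lee_fin speedE.
apply: ler_wpM2r; first exact: speed_ge0.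
apply: kK; apply: le_lt_trans lenB; rewrite -g0.
have t01 : 0 <= t <= 1 by rewrite t0.
apply: (le_trans (riemannian_edist_initial g pg t01)).
by rewrite (partial_length_cat g gamma t0 t1) leeDl// partial_length_ge0.
Qed.

End conformal_change.

(** * Differentiability and the chain rule from partial derivatives *)

Section partial_derivatives.
Context {R : realType} {n : nat}.
Implicit Types (b : 'rV[R]_n -> R) (x y k : 'rV[R]_n).
Local Notation e j := (delta_mx 0 j : 'rV[R]_n).

Lemma is_derive_line {V : normedModType R} (f : 'rV[R]_n -> V) x v (s : R) :
  derivable f (s *: v + x) v ->
  is_derive s 1 (fun t => f (t *: v + x)) ('D_v f (s *: v + x)).
Proof.
move=> df.
have E : (fun h : R => h^-1 *: ((fun t => f (t *: v + x)) (h *: 1 + s) -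
      f (s *: v + x))) =
    (fun h : R => h^-1 *: (f (h *: v + (s *: v + x)) - f (s *: v + x))).
  by apply/funext => h; rewrite addrA -scalerDl [h *: 1]mulr1.
split; first by rewrite /derivable /= E.
by rewrite /derive /= E.
Qed.

(** The mean value theorem on a segment in a coordinate direction, applied after subtracting the
    linear function of slope [c]. *)
Lemma mvt_partial b y j (a c eps : R) :
  (forall t : R, 0 <= t <= 1 -> derivable b ((t * a) *: e j + y) (e j)) ->
  (forall t : R, 0 <= t <= 1 -> `|'D_(e j) b ((t * a) *: e j + y) - c| <= eps) ->
  `|b (a *: e j + y) - b y - a * c| <= eps * `|a|.
Proof.
move=> db Db.
pose psi (s : R) := b (s *: e j + y).
pose phi (t : R) := psi (a * t + 0) - t * (a * c).
have dpsi (t : R) : 0 <= t <= 1 ->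
    is_derive t 1 (fun s => psi (a * s + 0)) (a *: 'D_(e j) b ((t * a) *: e j + y)).
  move=> t01; have [d dE] := is_derive_line (db t t01).
  have [] := @is_derive_affine _ _ psi a 0 t; first by rewrite addr0 mulrC.
  by rewrite addr0 mulrC derive1E dE; split.
have dphi (t : R) : 0 <= t <= 1 ->
    is_derive t 1 phi (a * ('D_(e j) b ((t * a) *: e j + y) - c)).
  move=> t01; have := dpsi t t01 => d.
  apply: is_derive_eq.
  rewrite /GRing.scale /= ; ring.
have [t tI|t|t tI E] := @MVT _ phi (fun t => a * ('D_(e j) b ((t * a) *: e j + y) - c)) 0 1 ltr01.
- by move: tI; rewrite in_itv/= => /andP[/ltW t0 /ltW t1]; apply: dphi; rewrite t0.
- apply: (derivable_within_continuous (i := `[0, 1])) => s.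
  by rewrite in_itv/= => /dphi[].
have : phi 1 - phi 0 = b (a *: e j + y) - b y - a * c.
  by rewrite /phi /psi mulr1 mulr0 !addr0 scale0r add0r mul1r mul0r subr0 addrAC.
rewrite E subr0 mulr1 => <-; rewrite normrM mulrC ler_wpM2r// Db//.
by move: tI; rewrite in_itv/= => /andP[/ltW -> /ltW ->].
Qed.

(** [smooth_on] speaks only of coordinate directions, so the first-order expansion has to be
    derived. The increment is made one coordinate at a time, and continuity of the partial
    derivatives at [y0] controls each step. *)
Lemma frechet_of_partials b (W : set 'rV[R]_n) y0 : open W -> W y0 ->
  (forall j y, W y -> derivable b y (e j)) ->
  (forall j, {for y0, continuous ('D_(e j) b)}) ->
  forall eps, 0 < eps -> exists2 delta, 0 < delta & forall k, `|k| < delta ->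
    `|b (k + y0) - b y0 - \sum_j k 0 j * 'D_(e j) b y0| <= eps * `|k|.
Proof.
move=> oW Wy0 db cb eps eps0.
(* There are [n] steps; dividing by [n.+1] also covers dimension 0. *)
pose eps' := eps / n.+1%:R.
have eps'0 : 0 < eps' by rewrite divr_gt0.
have : \forall y \near y0, W y /\
    forall j, `|'D_(e j) b y - 'D_(e j) b y0| <= eps'.
  near=> y; split; first by near: y; exact: open_nbhs_nbhs.
  near: y; apply: filter_forall => j.
  by move/cvgrPdist_le: (cb j) => /(_ _ eps'0); apply: filterS => y; rewrite distrC.
move=> /nbhs_ballP[delta /= delta0 H]; exists delta => // k kdelta.
pose tr (i : nat) : 'rV[R]_n := \row_j (if (j < i)%N then k 0 j else 0).
have trn : tr n = k.
  by apply/rowP => j; rewrite mxE ltn_ord.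
have tr0 : tr 0%N = 0 by apply/rowP => j; rewrite !mxE.
have trS (i : 'I_n) (t : R) : (t * k 0 i) *: e i + (tr i + y0) =
    (t *: (tr i.+1 - tr i) + tr i) + y0.
  rewrite addrA; congr (_ + y0); congr (_ + tr i).
  apply/rowP => j; rewrite !mxE eqxx/= ltnS -mulrA; congr (t * _).
  have [->|ji] := eqVneq j i; first by rewrite leqnn ltnn subr0 mulr1.
  by rewrite ltn_neqAle ji mulr0; case: ifP; rewrite /= subrr.
have coord (j : 'I_n) : `|k 0 j| <= `|k|.
  by rewrite [leRHS]/Num.Def.normr/= mx_normrE; apply: (le_bigmax _ _ (0, j)).
(* Each coordinate of the displacement lies between 0 and that of [k], so the sup norm does not
   exceed that of [k]. *)
have inball (i : 'I_n) (t : R) : 0 <= t <= 1 ->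
    ball y0 delta ((t * k 0 i) *: e i + (tr i + y0)).
  move=> /andP[t0 t1]; rewrite trS -ball_normE /ball_/= opprD addrCA subrr addr0 normrN.
  apply: le_lt_trans kdelta; rewrite [leLHS]/Num.Def.normr/= mx_normrE.
  apply: bigmax_le => // -[i0 j] _ /=; rewrite !mxE ltnS.
  have kj0 : `|0 : R| <= `|k| by rewrite normr0.
  case: (ltngtP j i) => /= ji; rewrite ?subrr ?subr0 ?mulr0 ?addr0 ?add0r//.
  by rewrite normrM ger0_norm// (le_trans _ (coord j))// ler_piMl.
have tele : b (k + y0) - b y0 =
    \sum_(j < n) (b (tr j.+1 + y0) - b (tr j + y0)).
  rewrite -(big_mkord xpredT (fun j => b (tr j.+1 + y0) - b (tr j + y0))).
  by rewrite telescope_sumr// trn tr0 add0r.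
rewrite tele -sumrB (le_trans (ler_norm_sum _ _ _))//.
apply: (@le_trans _ _ (\sum_(j < n) (eps' * `|k|))).
  apply: ler_sum => j _.
  have tj : tr j.+1 + y0 = k 0 j *: e j + (tr j + y0).
    by have := trS j 1; rewrite mul1r scale1r subrK => ->.
  rewrite tj; apply: (le_trans (@mvt_partial b (tr j + y0) j (k 0 j) _ eps' _ _)).
  - by move=> t /(inball j)/H[Wt _]; exact: db.
  - by move=> t /(inball j)/H[_]; exact.
  - by rewrite ler_wpM2l// ltW.
rewrite sumr_const card_ord -mulrnAl ler_wpM2r//.
rewrite /eps' -mulr_natr mulrAC ler_pdivrMr// ler_pM2l// ler_nat//.
Unshelve. all: by end_near. Qed.

End partial_derivatives.

(** [T] is only assumed derivable along [v]. Its difference quotient [q] is inserted into the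
    expansion of [b] at [T x], and the remainder is a small multiple of [q]. *)
Lemma is_derive_comp_partials {R : realType} {n m : nat}
    (b : 'rV[R]_m -> R) (T : 'rV[R]_n -> 'rV[R]_m) (W : set 'rV[R]_m) x v :
  open W -> W (T x) ->
  (forall j y, W y -> derivable b y (delta_mx 0 j)) ->
  (forall j, {for T x, continuous ('D_(delta_mx 0 j) b)}) ->
  derivable T x v ->
  is_derive x v (b \o T)
    (\sum_j ('D_v T x) 0 j * 'D_(delta_mx 0 j) b (T x)).
Proof.
move=> oW WTx db cb dT.
set l := \sum_j _.
pose q (h : R) := h^-1 *: (T (h *: v + x) - T x).
have qcvg : q h @[h --> 0^'] --> 'D_v T x by exact: dT.
have Tcvg : T (h *: v + x) @[h --> 0^'] --> T x.
  have /continuous_withinNx : {for 0, continuous (fun h : R => T (h *: v + x))}.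
    exact/differentiable_continuous/derivable1_diffP/(derivable1P _ _ _).1.
  by rewrite scale0r add0r.
pose lq (h : R) := \sum_j (q h) 0 j * 'D_(delta_mx 0 j) b (T x).
have lcvg : lq h @[h --> 0^'] --> l.
  apply: cvg_big => [|j _]; first exact: add_continuous.
  apply: cvgMr_tmp.
  apply: (@cvg_comp _ _ _ q (fun M : 'rV[R]_m => M 0 j) _ _ _ qcvg).
  exact: coord_continuous.
suff C : (fun h => h^-1 *: ((b \o T) (h *: v + x) - (b \o T) x)) h @[h --> 0^'] --> l.
  split; first by apply/cvg_ex; exists l.
  exact: (cvg_lim _ C).
rewrite (_ : (fun h => _) = (fun h =>
   (h^-1 *: (b (T (h *: v + x)) - b (T x)) - lq h) + lq h)); last first.
  by apply/funext => h; rewrite subrK.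
rewrite -[X in _ --> X]add0r; apply: cvgD => //.
apply/cvgrPdist_le => eps eps0.
(* A bound for [q] near 0; the added 1 makes it positive and leaves room for the convergence. *)
pose K := `|'D_v T x| + 1.
have K0 : 0 < K by rewrite ltr_wpDl.
have [|delta delta0 H] := frechet_of_partials oW WTx db cb (eps := eps / K).
  by rewrite divr_gt0.
have H1 : \forall h \near 0^', `|q h| <= K.
  move/cvgrPdist_le : qcvg => /(_ 1 ltr01); apply: filterS => h hq.
  rewrite -(subrK ('D_v T x) (q h)) addrC (le_trans (ler_normD _ _))// lerD2l.
  by rewrite distrC.
have H2 : \forall h \near 0^', `|T (h *: v + x) - T x| < delta.
  by move/cvgrPdist_lt : Tcvg => /(_ _ delta0); apply: filterS => h; rewrite distrC.
near=> h.
have h0 : h != 0 by near: h; exact: nbhs_dnbhs_neq.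
have H1h : `|q h| <= K by near: h.
have H2h : `|T (h *: v + x) - T x| < delta by near: h.
have := H _ H2h; rewrite subrK => Hh.
rewrite sub0r normrN /lq.
rewrite (_ : \sum_j _ = h^-1 * \sum_j ((T (h *: v + x) - T x) 0 j *
   'D_(delta_mx 0 j) b (T x))); last first.
  by rewrite mulr_sumr; apply: eq_bigr => j _; rewrite /q !mxE mulrA.
rewrite -[X in `|X - _|]/(h^-1 * _) -mulrBr normrM.
apply: (@le_trans _ _ (`|h^-1| * (eps / K * `|T (h *: v + x) - T x|))).
  by rewrite ler_wpM2l.
rewrite mulrCA -normrZ -[`|_ *: _|]/(`|q h|) mulrAC ler_pdivrMr// ler_pM2l//.
Unshelve. all: by end_near. Qed.

(** * Closure properties of smooth functions on open sets *)

Section smooth_functions.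
Context {R : realType} {n : nat}.
Local Notation e i := (delta_mx 0 i : 'rV[R]_n).
Implicit Types (U W : set 'rV[R]_n) (x v : 'rV[R]_n).

Lemma is_derive_scale {V : normedModType R} (a : 'rV[R]_n -> R)
    (f : 'rV[R]_n -> V) x v : derivable a x v -> derivable f x v ->
  is_derive x v (fun y => a y *: f y) (a x *: 'D_v f x + 'D_v a x *: f x).
Proof.
move=> da df.
suff C : (fun h => h^-1 *: (((fun y => a y *: f y) \o shift x) (h *: v) -
    a x *: f x)) @ 0^' --> a x *: 'D_v f x + 'D_v a x *: f x.
  by split; [apply/cvg_ex; eexists; exact: C|exact: (cvg_lim _ C)].
rewrite (_ : (fun h => _) = (fun h : R =>
    a (h *: v + x) *: (h^-1 *: (f (h *: v + x) - f x)) +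
    (h^-1 *: (a (h *: v + x) - a x)) *: f x)); last first.
  apply/funext => h /=; rewrite scalerA [a _ * _]mulrC -scalerA.
  rewrite -[X in _ + X *: _]/(h^-1 * _) -(scalerA h^-1 (a (h *: v + x) - a x)) -scalerDr.
  by congr (h^-1 *: _); rewrite scalerBl scalerBr addrA subrK.
apply: cvgD; last by apply: cvgZr_tmp; exact: da.
apply: cvgZ; last exact: df.
suff : {for 0, continuous (fun h : R => a (h *: v + x))}.
  by move=> /continuous_withinNx; rewrite scale0r add0r.
exact/differentiable_continuous/derivable1_diffP/(derivable1P _ _ _).1.
Qed.

Lemma smooth_on_continuous {V : normedModType R} U (f : 'rV[R]_n -> V) x :
  smooth_on U f -> U x -> {for x, continuous f}.
Proof. by move=> fU /(fU [::])[]. Qed.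

Lemma smooth_on_derivable {V : normedModType R} U (f : 'rV[R]_n -> V) x i :
  smooth_on U f -> U x -> derivable f x (e i).
Proof. by move=> fU /(fU [::])[_]; apply. Qed.

Lemma smooth_on_partial {V : normedModType R} U (f : 'rV[R]_n -> V) i :
  smooth_on U f -> smooth_on U ('D_(e i) f).
Proof. by move=> fU s x Ux; exact: (fU (i :: s)). Qed.

Lemma smooth_on_subset {V : normedModType R} U W (f : 'rV[R]_n -> V) :
  U `<=` W -> smooth_on W f -> smooth_on U f.
Proof. by move=> UW fW s x /UW; exact: fW. Qed.

Lemma smooth_on_cst {V : normedModType R} U (c : V) : smooth_on U (cst c).
Proof.
move=> s; elim: s c => [|i s IH] c x Ux /=.
  by split; [exact: cst_continuous|move=> i; exact: derivable_cst].
rewrite (_ : (fun y => 'D_(e i) (cst c) y) = cst 0); first exact: IH.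
by apply/funext => y; rewrite derive_cst.
Qed.

(* The module over the smooth functions on [U] generated by [G]. To prove that a
   function is smooth, find generators of such a module that it belongs to and
   whose partial derivatives stay in it. *)
Inductive smooth_span {V : normedModType R} U (G : set ('rV[R]_n -> V)) :
    ('rV[R]_n -> V) -> Prop :=
| span_gen f : G f -> smooth_span U G f
| span_add f h : smooth_span U G f -> smooth_span U G h ->
    smooth_span U G (fun x => f x + h x)
| span_scale a f : smooth_on (U : set 'rV[R]_n) (a : 'rV[R]_n -> R) ->
    smooth_span U G f -> smooth_span U G (fun x => a x *: f x)
| span_eq f h : (forall x, U x -> f x = h x) ->
    smooth_span U G f -> smooth_span U G h.

(** The member [f] only supplies the zero function [0 *: f], the value of an empty sum. *)
Lemma span_sum {V : normedModType R} U (G : set ('rV[R]_n -> V)) m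
    (F : 'I_m -> 'rV[R]_n -> V) f : smooth_span U G f ->
  (forall j, smooth_span U G (F j)) ->
  smooth_span U G (fun x => \sum_j F j x).
Proof.
move=> Gf GF.
suff : forall s : seq 'I_m, smooth_span U G (fun x => \sum_(j <- s) F j x) by [].
elim=> [|j s IH].
  apply: (@span_eq _ _ _ (fun x => cst 0 x *: f x)).
    by move=> x _; rewrite big_nil scale0r.
  exact (@span_scale _ _ _ (cst 0) f (@smooth_on_cst _ U 0) Gf).
apply: (@span_eq _ _ _ (fun x => F j x + \sum_(j <- s) F j x)).
  by move=> x _; rewrite big_cons.
exact: span_add.
Qed.

Lemma near_eq_on_open (V : Type) U (f h : 'rV[R]_n -> V) x : open U -> U x ->
  (forall y, U y -> f y = h y) -> \forall y \near x, f y = h y.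
Proof. by move=> oU Ux fh; near=> y; apply: fh; near: y; exact: open_nbhs_nbhs. 
Unshelve. all: by end_near. Qed.

(** By the Leibniz rule the whole module is stable under partial derivatives once the generators
    are, and all its members are continuous and derivable. The induction on the list of derivatives
    runs over all members at once. *)
Lemma smooth_span_smooth {V : normedModType R} U (G : set ('rV[R]_n -> V)) :
  open U ->
  (forall f x, G f -> U x -> {for x, continuous f} /\
     forall i, derivable f x (e i)) ->
  (forall f i, G f -> smooth_span U G ('D_(e i) f)) ->
  forall f, smooth_span U G f -> smooth_on U f.
Proof.
move=> oU G1 GD.
have span1 f : smooth_span U G f -> forall x, U x -> {for x, continuous f} /\
    forall i, derivable f x (e i).
  elim=> {f} [f Gf x Ux|f h _ IHf _ IHh x Ux|a f sa _ IHf x Ux|f h fh _ IHf x Ux].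
  - exact: G1.
  - have [cf df] := IHf x Ux; have [ch dh] := IHh x Ux; split.
      exact: (continuousD cf ch).
    by move=> i; apply: derivableD; [exact: df|exact: dh].
  - have [cf df] := IHf x Ux; split.
      exact: (cvgZ (smooth_on_continuous sa Ux) cf).
    by move=> i; have [] := is_derive_scale (smooth_on_derivable sa Ux) (df i).
  - have [cf df] := IHf x Ux; have E := near_eq_on_open oU Ux fh; split.
      suff : h @ x --> h x by []; rewrite -(nbhs_singleton E).
      by apply: cvg_trans cf; exact: (@near_eq_cvg _ _ (nbhs x) _ _ _ E).
    by move=> i; apply: (near_eq_derivable E).
have spanD f i : smooth_span U G f -> smooth_span U G ('D_(e i) f).
  elim=> {f} [f Gf|f h Gf IHf Gh IHh|a f sa Gf IHf|f h fh Gf IHf].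
  - exact: GD.
  - apply: (@span_eq _ _ _ (fun x => 'D_(e i) f x + 'D_(e i) h x)).
      by move=> x Ux; rewrite -deriveD//; apply: (proj2 (span1 _ _ x Ux)).
    exact: span_add.
  - apply: (@span_eq _ _ _ (fun x => a x *: 'D_(e i) f x + 'D_(e i) a x *: f x)).
      move=> x Ux; have df := proj2 (span1 _ Gf x Ux) i.
      by have [_ ->] := is_derive_scale (smooth_on_derivable sa Ux) df.
    exact (span_add (span_scale sa IHf) (span_scale (smooth_on_partial i sa) Gf)).
  - apply: (span_eq _ IHf) => x Ux.
    exact/near_eq_derive/(near_eq_on_open oU Ux fh).
move=> f + s; elim: s f => [|i s IH] f Gf x Ux; first exact: span1.
by apply: IH => //; exact: spanD.
Qed.

Lemma smooth_onD {V : normedModType R} U (f h : 'rV[R]_n -> V) : open U ->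
  smooth_on U f -> smooth_on U h -> smooth_on U (fun x => f x + h x).
Proof.
move=> oU sf sh; apply: (@smooth_span_smooth _ U [set k | smooth_on U k]) => //.
- move=> k x sk Ux; split; first exact: (smooth_on_continuous sk).
  by move=> i; exact: (smooth_on_derivable sk).
- by move=> k i sk; apply: span_gen; exact (smooth_on_partial i sk).
- by apply: span_add; exact: span_gen.
Qed.

Lemma smooth_onZ {V : normedModType R} U (a : 'rV[R]_n -> R)
    (f : 'rV[R]_n -> V) : open U ->
  smooth_on U a -> smooth_on U f -> smooth_on U (fun x => a x *: f x).
Proof.
move=> oU sa sf; apply: (@smooth_span_smooth _ U [set k | smooth_on U k]) => //.
- move=> k x sk Ux; split; first exact: (smooth_on_continuous sk).
  by move=> i; exact: (smooth_on_derivable sk).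
- by move=> k i sk; apply: span_gen; exact (smooth_on_partial i sk).
- exact (span_scale sa (span_gen _ sf)).
Qed.

Lemma smooth_onM U (a b : 'rV[R]_n -> R) : open U ->
  smooth_on U a -> smooth_on U b -> smooth_on U (fun x => a x * b x).
Proof. exact: (@smooth_onZ R). Qed.

Lemma smooth_on_prod U (I : Type) (r : seq I) (F : I -> 'rV[R]_n -> R) :
  open U -> (forall i, smooth_on U (F i)) ->
  smooth_on U (fun x => \prod_(i <- r) F i x).
Proof.
move=> oU sF; elim: r => [|i r IH].
  by rewrite (_ : (fun x => _) = cst 1);
    [exact: smooth_on_cst|apply/funext => x; rewrite big_nil].
rewrite (_ : (fun x => _) = (fun x => F i x * \prod_(i <- r) F i x)).
  exact (smooth_onM oU (sF i) IH).
by apply/funext => x; rewrite big_cons.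
Qed.

Lemma smooth_on_sum U (I : Type) (r : seq I) (F : I -> 'rV[R]_n -> R) :
  open U -> (forall i, smooth_on U (F i)) ->
  smooth_on U (fun x => \sum_(i <- r) F i x).
Proof.
move=> oU sF; elim: r => [|i r IH].
  by rewrite (_ : (fun x => _) = cst 0);
    [exact: smooth_on_cst|apply/funext => x; rewrite big_nil].
rewrite (_ : (fun x => _) = (fun x => F i x + \sum_(i <- r) F i x)).
  exact (smooth_onD oU (sF i) IH).
by apply/funext => x; rewrite big_cons.
Qed.

Lemma smooth_on_coord U m k (F : 'rV[R]_n -> 'M[R]_(m, k)) i j : open U ->
  smooth_on U F -> smooth_on U (fun x => F x i j).
Proof.
move=> oU sF; apply: (@smooth_span_smooth _ U [set h | exists F' : _ -> 'M[R]_(m, k),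
    smooth_on U F' /\ h = (fun x => F' x i j)]) => //.
- move=> _ x [F' [sF' ->]] Ux; split.
    apply: (@continuous_comp _ _ _ F' (fun M : 'M[R]_(m, k) => M i j)).
      exact: (smooth_on_continuous sF').
    exact: coord_continuous.
  move=> l; apply: (proj1 (derivable_mxP _ _ _)).
  exact: (smooth_on_derivable sF').
- move=> _ l [F' [sF' ->]].
  apply: (@span_eq _ _ _ (fun x => 'D_(e l) F' x i j)).
    move=> x Ux; rewrite (derive_mx (smooth_on_derivable sF' Ux)) mxE.
    reflexivity.
  apply: span_gen; exists ('D_(e l) F'); split; last by [].
  exact (smooth_on_partial l sF').
- by apply: span_gen; exists F.
Qed.

(** The generators are all [b' \o T] with [b'] smooth on [W]; the chain rule has the partial
    derivatives of [T] as coefficients. *)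
Lemma smooth_on_comp m U (W : set 'rV[R]_m) (b : 'rV[R]_m -> R)
    (T : 'rV[R]_n -> 'rV[R]_m) : open U -> open W ->
  (forall x, U x -> W (T x)) -> smooth_on W b -> smooth_on U T ->
  smooth_on U (b \o T).
Proof.
move=> oU oW TW sb sT.
have D b' x i : smooth_on W b' -> U x -> is_derive x (e i) (b' \o T)
    (\sum_j ('D_(e i) T x) 0 j * 'D_(delta_mx 0 j) b' (T x)).
  move=> sb' Ux; apply: (is_derive_comp_partials oW).
  - exact: TW.
  - by move=> j y Wy; case: (sb' [::] y Wy) => _; apply.
  - by move=> j; case: (sb' [:: j] (T x) (TW x Ux)).
  - exact: (smooth_on_derivable sT).
apply: (@smooth_span_smooth _ U [set h | exists b', smooth_on W b' /\ h = b' \o T]) => //.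
- move=> _ x [b' [sb' ->]] Ux; split.
    apply: continuous_comp; first exact: (smooth_on_continuous sT).
    by case: (sb' [::] (T x) (TW x Ux)).
  by move=> i; case: (D b' x i sb' Ux).
- move=> _ i [b' [sb' ->]].
  apply: (@span_eq _ _ _ (fun x =>
      \sum_j ('D_(e i) T x) 0 j *: 'D_(delta_mx 0 j) b' (T x))).
    by move=> x Ux; have [_ ->] := D b' x i sb' Ux.
  apply: (span_sum (f := b' \o T)); first by apply: span_gen; exists b'.
  move=> j; apply: span_scale.
    exact (smooth_on_coord 0 j oU (smooth_on_partial i sT)).
  apply: span_gen; exists ('D_(delta_mx 0 j) b'); split; last by [].
  by move=> s y Wy; exact: (sb' (j :: s)).
- by apply: span_gen; exists b.
Qed.

(** The generators are the positive powers of the inverse: the derivative of one is a smooth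
    multiple of the next. *)
Lemma smooth_onV U (a : 'rV[R]_n -> R) : open U ->
  (forall x, U x -> a x != 0) -> smooth_on U a ->
  smooth_on U (fun x => (a x)^-1).
Proof.
move=> oU a0 sa.
have D k x i : U x -> is_derive x (e i) (fun x => (a x)^-1 ^+ k.+1)
    ((- k.+1%:R * 'D_(e i) a x) * (a x)^-1 ^+ k.+2).
  move=> Ux; have da : is_derive x (e i) a ('D_(e i) a x).
    exact/derivableP/(smooth_on_derivable sa).
  have ax := a0 x Ux.
  have dV : is_derive x (e i) (fun x => (a x)^-1) (- (a x) ^- 2 *: 'D_(e i) a x).
    by split; [apply: derivableV|apply: deriveV].
  rewrite (_ : (fun y => _) = (fun y => (a y)^-1) ^+ k.+1); last first.
    by apply/funext => y; rewrite exprfctE.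
  have [d dE] := is_deriveX k.+1 dV; split; first exact: d.
  rewrite dE /GRing.scale /= -exprVn !exprS; ring.
apply: (@smooth_span_smooth _ U
  [set h | exists k, h = (fun x => (a x)^-1 ^+ k.+1)]) => //.
- move=> _ x [k ->] Ux; split; last by move=> i; case: (D k x i Ux).
  have cV : {for x, continuous (fun y => (a y)^-1)}.
    exact (cvgV (a0 x Ux) (smooth_on_continuous sa Ux)).
  elim: k => [|k IH].
    rewrite (_ : (fun y => _) = (fun y => (a y)^-1))//.
  rewrite (_ : (fun y => _) = (fun y => (a y)^-1 * (a y)^-1 ^+ k.+1)).
    exact: (cvgM cV IH).
  by apply/funext => y; rewrite exprS.
- move=> _ i [k ->].
  apply: (@span_eq _ _ _ (fun x => (- k.+1%:R * 'D_(e i) a x) *: (a x)^-1 ^+ k.+2)).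
    by move=> x Ux; have [_ ->] := D k x i Ux.
  apply: span_scale; last by apply: span_gen; exists k.+1.
  exact (smooth_onM oU (@smooth_on_cst _ U _) (smooth_on_partial i sa)).
- by apply: span_gen; exists 0%N; apply/funext => x; rewrite expr1.
Qed.

Lemma smooth_on_local {V : normedModType R} U (f : 'rV[R]_n -> V) :
  (forall x, U x -> exists (D : set 'rV[R]_n) h, [/\ open D, D x, smooth_on D h &
     forall y, D y -> f y = h y]) -> smooth_on U f.
Proof.
move=> H s x Ux.
have [D [h [oO Ox sh fh]]] := H x Ux.
clear H Ux.
suff : forall y, D y -> iter_partial f s y = iter_partial h s y.
  move=> E; have [ch dh] := sh s x Ox.
  have {}E : \forall y \near x, iter_partial h s y = iter_partial f s y.
    by apply: (near_eq_on_open oO Ox) => y Oy; rewrite E.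
  split; last by move=> i; exact: (near_eq_derivable E).
  suff : iter_partial f s @ x --> iter_partial f s x by [].
  rewrite -(nbhs_singleton E).
  by apply: cvg_trans ch; exact: (@near_eq_cvg _ _ (nbhs x) _ _ _ E).
clear sh; revert f h fh; elim: s => [|i s IH] f h fh y Oy /=; first exact: fh.
apply: IH => // z Oz.
exact/near_eq_derive/(near_eq_on_open oO Oz).
Qed.

End smooth_functions.

(** * A flat function and smooth bumps *)

Section flat_function.
Context {R : realType}.
Implicit Types (t : R) (k : nat).

(* All [k] at once, because the derivative of [flat k] is
   [flat k.+2 - k * flat k.+1]. *)
Definition flat k t : R := if 0 < t then t ^- k * expR (- t^-1) else 0.

Lemma flat_ge0 k t : 0 <= flat k t.
Proof.
rewrite /flat; case: ifPn => // t0.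
by rewrite mulr_ge0 ?expR_ge0// invr_ge0 exprn_ge0 ?ltW.
Qed.

Lemma flat_gt0 k t : 0 < t -> 0 < flat k t.
Proof. by move=> t0; rewrite /flat t0 mulr_gt0 ?expR_gt0// invr_gt0 exprn_gt0. Qed.

Lemma flat_le0 k t : t <= 0 -> flat k t = 0.
Proof. by rewrite /flat leNgt => /negbTE ->. Qed.

(** The term of order [k.+1] in the exponential series of [t^-1] beats [t ^- k] with one power of
    [t] to spare, as the derivative at 0 requires. *)
Lemma flat_bound k t : `|flat k t| <= k.+1`!%:R * `|t|.
Proof.
have [t0|t0] := leP t 0; first by rewrite flat_le0// normr0 mulr_ge0.
rewrite !ger0_norm ?flat_ge0 ?(ltW t0)// /flat t0 expRN.
have tV0 : 0 <= t^-1 by rewrite invr_ge0 ltW.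
have f0 : 0 < k.+1`!%:R :> R by rewrite ltr0n fact_gt0.
have le : t^-1 ^+ k.+1 / k.+1`!%:R <= expR t^-1.
  by apply: le_trans (expR_ge1Dxn k tV0); rewrite lerDr.
rewrite -[_ * _^-1]/(_ / _) ler_pdivrMr ?expR_gt0//.
apply: le_trans (ler_wpM2l _ le); last by rewrite mulr_ge0 ?ltW.
rewrite -exprVn exprS le_eqVlt; apply/orP; left; apply/eqP.
by field; rewrite !gt_eqF.
Qed.

Lemma is_derive_flat k t :
  is_derive t 1 (flat k) (flat k.+2 t - k%:R * flat k.+1 t).
Proof.
have [t0|t0|->] := ltgtP t 0.
- have E : \forall s \near t, cst 0 s = flat k s.
    near=> s; rewrite flat_le0// ltW//; near: s.
    by apply: open_nbhs_nbhs; split => //; exact: open_lt.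
  rewrite !flat_le0 ?(ltW t0)// mulr0 subr0.
  apply: (near_eq_is_derive E); exact: is_derive_cst.
- have E : \forall s \near t, s^-1 ^+ k * expR (- s^-1) = flat k s.
    near=> s; rewrite /flat; suff -> : 0 < s by rewrite exprVn.
    near: s; by apply: open_nbhs_nbhs; split => //; exact: open_gt.
  apply: (near_eq_is_derive E).
  have tn0 : t != 0 by rewrite gt_eqF.
  have dV : is_derive t 1 (fun s : R => s^-1) (- t ^- 2).
    have did := @derivable_id R R t 1.
    split; first exact: (derivableV tn0 did).
    by rewrite (deriveV tn0 did) derive_id /GRing.scale/= mulr1.
  have dN : is_derive t 1 (fun s : R => - s^-1) (t ^- 2).
    by apply: is_derive_eq; rewrite opprK.
  have dE : is_derive t 1 (fun s : R => expR (- s^-1)) (t ^- 2 * expR (- t^-1)).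
    by apply: is_derive_eq; rewrite mulrC.
  have dX : is_derive t 1 (fun s : R => s^-1 ^+ k)
      ((k%:R * t^-1 ^+ k.-1) *: - t ^- 2).
    rewrite (_ : (fun s => _) = (fun s : R => s^-1) ^+ k); first exact: is_deriveX.
    by apply/funext => s; rewrite exprfctE.
  have dM := is_deriveM dX dE.
  rewrite -[fun s => _]/((fun s : R => s^-1 ^+ k) * (fun s => expR (- s^-1))).
  apply: is_derive_eq.
  rewrite /flat t0 /GRing.scale /= -!exprVn.
  case: k {E dX dM} => [|k]; rewrite /= !exprS; ring.
- rewrite flat_le0// flat_le0// mulr0 subr0.
  suff C : (fun h => h^-1 *: (flat k (h *: 1 + 0) - flat k 0)) h @[h --> 0^'] --> (0 : R).
    by split; [apply/cvg_ex; exists 0; exact: C|exact: (cvg_lim _ C)].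
  have f0 : 0 < k.+2`!%:R :> R by rewrite ltr0n fact_gt0.
  apply/cvgrPdist_le => e e0; near=> h.
  have h0 : h != 0 by near: h; exact: nbhs_dnbhs_neq.
  rewrite sub0r normrN (flat_le0 _ (lexx 0)) subr0 addr0 [h *: 1]mulr1.
  (* The difference quotient at 0 is the next flat function, which tends to 0 by [flat_bound]. *)
  rewrite (_ : h^-1 *: _ = flat k.+1 h).
    apply: (le_trans (flat_bound _ _)); rewrite -ler_pdivlMl//.
    by near: h; apply: dnbhs0_le; rewrite mulr_gt0// invr_gt0.
  rewrite /flat; case: ifPn => [hp|]; last by rewrite scaler0.
  by rewrite /GRing.scale /= exprS invfM mulrA.
Unshelve. all: by end_near. Qed.

End flat_function.

Lemma is_derive1P {R : realType} {V W : normedModType R} (f : V -> W) (x v : V) (l : W) :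
  is_derive (0 : R) (1 : R) (fun h : R => f (h *: v + x)) l -> is_derive x v f l.
Proof.
move=> [d dE]; split; first exact: (proj2 (derivable1P f x v) d).
rewrite -dE /derive; set g1 := fun h => h^-1 *: _; set g2 := fun h => h^-1 *: _.
suff -> : g1 = g2 by []; apply/funext => h; rewrite /g1 /g2 /=.
by rewrite scale0r add0r addr0 [h *: 1]mulr1.
Qed.

Section bump_function.
Context {R : realType} {n : nat}.
Implicit Types (U : set 'rV[R]_n) (a v : 'rV[R]_n).

(** The generators are the functions [flat k'], for all [k'], of the same affine function of one
    coordinate. *)
Lemma smooth_on_flat U k c d (j : 'I_n) : open U ->
  smooth_on U (fun v => flat k (c * v 0 j + d)).
Proof.
move=> oU.
have D k' x i : is_derive x (delta_mx 0 i) (fun v : 'rV[R]_n => flat k' (c * v 0 j + d))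
    ((c * (i == j)%:R) *
      (flat k'.+2 (c * x 0 j + d) - k'%:R * flat k'.+1 (c * x 0 j + d))).
  apply: is_derive1P.
  have E : (fun h : R => flat k' (c * (h *: delta_mx 0 i + x) 0 j + d)) =
      (fun h : R => flat k' (c * (i == j)%:R * h + (c * x 0 j + d))).
    by apply/funext => h; congr flat; rewrite !mxE eqxx /= eq_sym; ring.
  rewrite E.
  have [dd dE] := is_derive_flat k' (c * x 0 j + d).
  have := @is_derive_affine _ _ (flat k') (c * (i == j)%:R) (c * x 0 j + d) 0.
  by rewrite mulr0 add0r derive1E dE => /(_ dd).
apply: (@smooth_span_smooth _ _ _ U
  [set h | exists k', h = fun v => flat k' (c * v 0 j + d)]) => //.
- move=> _ x [k' ->] Ux; split; last by move=> i; case: (D k' x i).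
  apply: (@continuous_comp _ _ _ (fun v : 'rV[R]_n => c * v 0 j + d) (flat k')).
    have cx : v 0 j @[v --> x] --> (x : 'rV[R]_n) 0 j by exact: coord_continuous.
    have cM : c * v 0 j @[v --> x] --> c * x 0 j by exact: cvgMl_tmp.
    exact (cvgD cM (cvg_cst d)).
  by apply/differentiable_continuous/derivable1_diffP; case: (is_derive_flat k' (c * x 0 j + d)).
- move=> _ i [k' ->].
  apply: (@span_eq _ _ _ _ _ (fun v => cst (c * (i == j)%:R) v *: flat k'.+2 (c * v 0 j + d) +
      cst (- (c * (i == j)%:R * k'%:R)) v *: flat k'.+1 (c * v 0 j + d))).
    move=> x _; have [_ ->] := D k' x i; rewrite /GRing.scale /=; ring.
  apply: span_add.
    refine (@span_scale _ _ _ _ _ (cst _) _ (smooth_on_cst _) _).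
    by apply: span_gen; exists k'.+2.
  refine (@span_scale _ _ _ _ _ (cst _) _ (smooth_on_cst _) _).
  by apply: span_gen; exists k'.+1.
- by apply: span_gen; exists k.
Qed.

(** Positive exactly on the open cube of half-side [eps] about [a], which is a ball of the sup norm.
    The factors 1 and -1 match the affine form in [smooth_on_flat]. *)
Definition smooth_bump a (eps : R) v : R :=
  \prod_j (flat 0 (1 * v 0 j + (eps - a 0 j)) * flat 0 (-1 * v 0 j + (eps + a 0 j))).

Lemma smooth_on_bump U a eps : open U -> smooth_on U (smooth_bump a eps).
Proof.
move=> oU; apply: (smooth_on_prod _ oU) => j.
exact (smooth_onM oU (smooth_on_flat _ _ _ _ oU) (smooth_on_flat _ _ _ _ oU)).
Qed.

Lemma smooth_bump_ge0 a eps v : 0 <= smooth_bump a eps v.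
Proof. by apply: prodr_ge0 => j _; rewrite mulr_ge0 ?flat_ge0. Qed.

Lemma smooth_bump_center a eps : 0 < eps -> 0 < smooth_bump a eps a.
Proof.
move=> e0; apply: prodr_gt0 => j _; rewrite mulr_gt0 ?flat_gt0//.
  by rewrite mul1r addrC subrK.
by rewrite mulN1r addrC addrK.
Qed.

Lemma smooth_bump_support a eps v : 0 < eps -> smooth_bump a eps v != 0 -> `|v - a| < eps.
Proof.
move=> e0; rewrite prodf_seq_neq0 => /allP H.
rewrite [ltLHS]/Num.Def.normr/= mx_normrE; apply: bigmax_lt => // -[i j] _.
have := H j; rewrite mem_index_enum => /(_ isT) /=.
rewrite mulf_eq0 negb_or mul1r mulN1r => /andP[H1 H2].
rewrite !mxE ord1 ltr_norml; apply/andP; split; rewrite ltNge; apply/negP => le.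
  by move/eqP: H1; apply; rewrite flat_le0//; lra.
by move/eqP: H2; apply; rewrite flat_le0//; lra.
Qed.

End bump_function.

(** * Smooth functions and averaging on manifolds *)

Section smooth_functions_on_manifolds.
Context {R : realType} {n : nat} {M : topologicalType}
  (S : smooth_manifold R n M).
Implicit Types (f : M -> R) (c : chart R n M) (x y : M).

Lemma chart_continuous c x : chart_dom c x -> {for x, continuous c}.
Proof.
have [_ _ cc _] := chart_homeo c.
move: cc; rewrite (continuous_open_subspace _ (@open_chart_dom _ _ _ c)) => cc cx.
by apply: cc; rewrite inE.
Qed.

Lemma chart_inv_continuous c v : chart_cod c v ->
  {for v, continuous (chart_inv c)}.
Proof.
have [_ _ _ cc] := chart_homeo c.
move: cc; rewrite (continuous_open_subspace _ (@open_chart_cod _ _ _ c)) => cc cv.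
by apply: cc; rewrite inE.
Qed.

Lemma chart_cod_map c x : chart_dom c x -> chart_cod c (c x).
Proof. by have [[H _] _ _ _] := chart_homeo c; exact: H. Qed.

Lemma chart_dom_inv c v : chart_cod c v -> chart_dom c (chart_inv c v).
Proof. by have [[_ H] _ _ _] := chart_homeo c; exact: H. Qed.

Lemma chart_mapK c x : chart_dom c x -> chart_inv c (c x) = x.
Proof. by have [_ [H _] _ _] := chart_homeo c => cx; apply: H; rewrite inE. Qed.

Lemma chart_invK c v : chart_cod c v -> c (chart_inv c v) = v.
Proof. by have [_ [_ H] _ _] := chart_homeo c => cx; apply: H; rewrite inE. Qed.

Lemma open_chart_preimage c (N : set M) : open N ->
  open (chart_cod c `&` chart_inv c @^-1` N).
Proof.
move=> oN; rewrite openE => v [cv Nv].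
have cN : nbhs v (chart_inv c @^-1` N).
  by apply: (chart_inv_continuous cv); exact: open_nbhs_nbhs.
apply: filterI => //.
by apply: open_nbhs_nbhs; split => //; exact: open_chart_cod.
Qed.

Definition manifold_smooth f : Prop :=
  forall c, atlas S c -> smooth_on (chart_cod c) (f \o chart_inv c).

Lemma manifold_smooth_continuous f : manifold_smooth f -> continuous f.
Proof.
move=> sf x; have cx := chart_at_dom S x.
have cc := chart_cod_map cx.
have c1 : {for chart_at S x x, continuous (f \o chart_inv (chart_at S x))}.
  exact (smooth_on_continuous (sf _ (chart_at_atlas S x)) cc).
have c2 : {for x, continuous ((f \o chart_inv (chart_at S x)) \o chart_at S x)}.
  by apply: continuous_comp; [exact: chart_continuous|exact: c1].
have E : \forall y \near x,
    ((f \o chart_inv (chart_at S x)) \o chart_at S x) y = f y.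
  have := open_nbhs_nbhs (conj (@open_chart_dom _ _ _ (chart_at S x)) cx).
  by apply: filterS => y yc /=; rewrite chart_mapK.
suff : f @ x --> f x by [].
rewrite -(nbhs_singleton E).
by apply: cvg_trans c2; exact: (@near_eq_cvg _ _ (nbhs x) _ _ _ E).
Qed.

Lemma manifold_smooth_sum (I : Type) (r : seq I) (a : I -> R) (F : I -> M -> R) :
  (forall i, manifold_smooth (F i)) ->
  manifold_smooth (fun x => \sum_(i <- r) a i * F i x).
Proof.
move=> sF c ac.
apply: (@smooth_on_sum _ _ _ _ r (fun i v => a i * F i (chart_inv c v))).
  exact: open_chart_cod.
move=> i; exact (smooth_onM (@open_chart_cod _ _ _ c) (smooth_on_cst (a i)) (sF i c ac)).
Qed.

Lemma manifold_smooth_div f h : (forall x, h x != 0) ->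
  manifold_smooth f -> manifold_smooth h -> manifold_smooth (fun x => f x / h x).
Proof.
move=> h0 sf sh c ac.
refine (smooth_onM (@open_chart_cod _ _ _ c) (sf c ac)
  (smooth_onV (@open_chart_cod _ _ _ c) _ (sh c ac))).
by move=> v _; exact: h0.
Qed.

(** A bump in one chart is extended by 0. Its support lies in the image of a compact ball, which is
    closed because the manifold is Hausdorff; so the extension is smooth across the boundary of the
    chart domain. *)
Lemma manifold_bump x0 (N : set M) : open N -> N x0 ->
  exists beta : M -> R, [/\ manifold_smooth beta, forall y, 0 <= beta y,
    0 < beta x0 & forall y, beta y != 0 -> N y].
Proof.
move=> oN Nx0; set c := chart_at S x0.
have cx : chart_dom c x0 := chart_at_dom S x0.
have ac : atlas S c := chart_at_atlas S x0.
pose a := c x0.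
have /nbhs_ballP[e /= e0 He] : nbhs a (chart_cod c `&` chart_inv c @^-1` N).
  apply: open_nbhs_nbhs; split; first exact: open_chart_preimage.
  by split; [exact: chart_cod_map|rewrite /preimage/= chart_mapK].
(* Half the radius, so that the closed ball [B] still lies in the chart. *)
pose eps := e / 2.
have eps0 : 0 < eps by rewrite divr_gt0.
have epse : eps < e by rewrite ltr_pdivrMr// ltr_pMr// ltr1n.
pose B := [set v : 'rV[R]_n | `|v - a| <= eps].
have BQ v : B v -> chart_cod c v /\ N (chart_inv c v).
  move=> Bv; apply: He; rewrite -ball_normE /ball_/= distrC.
  exact: le_lt_trans epse.
have cB : compact B.
  apply: bounded_closed_compact.
    exists (`|a| + eps); split; first exact: num_real.
    move=> t tb v /= Bv; apply: ltW; apply: le_lt_trans tb.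
    by rewrite -(subrK a v) addrC (le_trans (ler_normD _ _))// lerD2l.
  apply: (@closed_comp _ _ (fun v : 'rV[R]_n => `|v - a|) [set r | r <= eps]).
    move=> v _; have vc : w - a @[w --> v] --> v - a.
      exact (cvgB cvg_id (cvg_cst a)).
    exact: cvg_norm vc.
  exact: closed_le.
have clK : closed (chart_inv c @` B).
  apply: compact_closed; first exact: (manifold_hausdorff S).
  apply: continuous_compact cB.
  have [_ _ _ cc] := chart_homeo c.
  by apply: continuous_subspaceW cc => v /BQ[].
pose beta y := if y \in chart_dom c then smooth_bump a eps (c y) else 0.
have bE y : beta y != 0 -> chart_dom c y /\ `|c y - a| < eps.
  rewrite /beta; case: ifPn; last by rewrite eqxx.
  by rewrite inE => yc /(smooth_bump_support eps0).
exists beta; split.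
- move=> c' ac'; apply: smooth_on_local => v c'v.
  have [yc|yNc] := pselect (chart_dom c (chart_inv c' v)).
    exists (chart_cod c' `&` chart_inv c' @^-1` (chart_dom c)).
    exists (smooth_bump a eps \o transition c' c); split.
    + by apply: open_chart_preimage; exact: open_chart_dom.
    + by split.
    + have oD : open (chart_cod c' `&` chart_inv c' @^-1` (chart_dom c)).
        by apply: open_chart_preimage; exact: open_chart_dom.
      refine (smooth_on_comp oD (@openT _) _ (smooth_on_bump a eps (@openT _)) _).
        by [].
      refine (smooth_on_subset _ (smooth_transition ac' ac)).
      move=> w [c'w cw]; exists (chart_inv c' w); last exact: chart_invK.
      by split => //; exact: chart_dom_inv.
    + by move=> w [c'w cw] /=; rewrite /beta mem_set.
  (* Outside the chart domain a point avoids the closed image of [B], hence has a neighborhood on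
     which [beta] vanishes. *)
  exists (chart_cod c' `&` chart_inv c' @^-1` (~` (chart_inv c @` B))), (cst 0); split.
  + by apply: open_chart_preimage; exact: closed_openC.
  + split => // -[w Bw wE]; apply: yNc; rewrite -wE; apply: chart_dom_inv.
    by case: (BQ w Bw).
  + exact: smooth_on_cst.
  + move=> w [c'w cw] /=; apply/eqP; apply: contrapT => /negP/bE[zc zB].
    by apply: cw; exists (c (chart_inv c' w)); [exact: ltW|rewrite chart_mapK].
- by move=> y; rewrite /beta; case: ifP => // _; exact: smooth_bump_ge0.
- by rewrite /beta mem_set//; exact: smooth_bump_center.
- by move=> y /bE[yc yB]; rewrite -(chart_mapK yc); case: (BQ (c y)) => //; exact: ltW.
Qed.

(* [kappa] is a convex combination of values of [k] at points that are close
   in the sense of [N]. *)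
Lemma smooth_averaging (N : M -> set M) (k : M -> R) : compact [set: M] ->
  (forall x, open (N x)) -> (forall x, N x x) -> (forall x, 0 < k x) ->
  exists kappa : M -> R, [/\ manifold_smooth kappa, forall y, 0 < kappa y,
    exists C, forall y, kappa y <= C &
    forall y lo hi, (forall x, N x y -> lo <= k x <= hi) ->
      lo <= kappa y <= hi].
Proof.
move=> cM oN Nx k0.
(* A base point is used to pass to a finite subcover, so the empty manifold is treated apart. *)
have [[x0 _]|M0] := pselect (exists x : M, True); last first.
  have N0 (x : M) : False by apply: M0; exists x.
  exists (cst 1); split=> [c _||| y]; [exact: smooth_on_cst|by []|by exists 1|].
  by have := N0 y.
have /choice[beta Hb] := fun x => manifold_bump (oN x) (Nx x).
have sb x : manifold_smooth (beta x) by case: (Hb x).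
have b0 x y : 0 <= beta x y by case: (Hb x).
have bN x y : beta x y != 0 -> N x y by case: (Hb x) => _ _ _; apply.
have [D _ Dcov] : finite_subset_cover [set: M] (fun x => [set y | 0 < beta x y]) [set: M].
  pose M' : ptopologicalType := HB.pack M (isPointed.Build M x0).
  have cM' : @compact M' [set: M'] := cM.
  move: cM'; rewrite compact_cover; apply.
    move=> x _; apply: (@open_comp _ _ (beta x) [set r | 0 < r]) => //.
    by move=> y _; apply: manifold_smooth_continuous.
  by move=> y _; exists y => //=; case: (Hb y).
pose s : seq M := finmap.enum_fset D.
pose den y := \sum_(x <- s) 1 * beta x y.
pose num y := \sum_(x <- s) k x * beta x y.
have pos (h : M -> R) y : (forall x, 0 < h x) ->
    0 < \sum_(x <- s) h x * beta x y.
  move=> h0; have [x /= xD bxy] := Dcov y Logic.I.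
  rewrite (big_rem x)//= ltr_pwDl ?mulr_gt0//.
  by apply: sumr_ge0 => z _; rewrite mulr_ge0// ltW.
have den0 y : 0 < den y by exact: (pos (fun=> 1)).
have num0 y : 0 < num y by exact: pos.
exists (fun y => num y / den y); split.
- apply: manifold_smooth_div; first by move=> y; rewrite gt_eqF.
    exact: manifold_smooth_sum.
  exact: manifold_smooth_sum.
- by move=> y; rewrite divr_gt0.
- exists (\sum_(x <- s) k x) => y; rewrite ler_pdivrMr// /num /den mulr_sumr.
  rewrite big_seq [leRHS]big_seq; apply: ler_sum => x xs.
  rewrite mul1r ler_wpM2r// (big_rem x)//= lerDl.
  by apply: sumr_ge0 => z _; rewrite ltW.
- move=> y lo hi H; rewrite ler_pdivlMr// ler_pdivrMr// /num /den !mulr_sumr.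
  apply/andP; split; apply: ler_sum => x _; rewrite mul1r.
    have [->|/bN/H/andP[lok _]] := eqVneq (beta x y) 0; first by rewrite !mulr0.
    by rewrite ler_wpM2r.
  have [->|/bN/H/andP[_ khi]] := eqVneq (beta x y) 0; first by rewrite !mulr0.
  by rewrite ler_wpM2r.
Qed.

End smooth_functions_on_manifolds.

Lemma conformal_metric {R : realType} {n : nat} {M : topologicalType}
    {S : smooth_manifold R n M} (g : riemannian_metric S) (kappa : M -> R) :
  manifold_smooth S kappa -> (forall x, 0 < kappa x) ->
  exists g' : riemannian_metric S, forall gamma t,
    speed g' gamma t = kappa (gamma t) * speed g gamma t.
Proof.
move=> sk k0.
pose gr (c : chart R n M) (x : M) : 'M[R]_n := kappa x ^+ 2 *: gram g c x.
have grE c x v w : bilin (gr c x) v w = kappa x ^+ 2 * bilin (gram g c x) v w.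
  by rewrite /bilin /gr -scalemxAr -scalemxAl mxE.
have gr_sym c x : atlas S c -> chart_dom c x -> (gr c x)^T = gr c x.
  by move=> ac cx; rewrite /gr linearZ/= gram_sym.
have gr_pos c x v : atlas S c -> chart_dom c x -> v != 0 -> 0 < bilin (gr c x) v v.
  by move=> ac cx v0; rewrite grE mulr_gt0 ?exprn_gt0// gram_posdef.
have gr_smooth c : atlas S c -> smooth_on (chart_cod c) (gr c \o chart_inv c).
  move=> ac; have oc := @open_chart_cod _ _ _ c.
  refine (smooth_onZ oc (smooth_onM oc (sk c ac) (sk c ac)) (gram_smooth g ac)).
have gr_change c c' x v w : atlas S c -> atlas S c' ->
    chart_dom c x -> chart_dom c' x ->
    bilin (gr c x) v w =
    bilin (gr c' x) ('D_v (transition c c') (c x))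
                    ('D_w (transition c c') (c x)).
  by move=> ac ac' cx c'x; rewrite !grE -gram_change.
exists (RiemannianMetric gr_sym gr_pos gr_smooth gr_change) => gamma t.
rewrite /speed /= grE sqrtrM ?sqr_ge0// sqrtr_sqr gtr0_norm//.
Qed.

(** * Metric spaces from distances, and a Gromov-Hausdorff bound *)

Section metric_of_distance.
Context {R : realType} (T : choiceType) (d : T -> T -> R).
Hypothesis dxx : forall x, d x x = 0.
Hypothesis d_eq0 : forall x y, d x y = 0 -> x = y.
Hypothesis d_sym : forall x y, d x y = d y x.
Hypothesis d_tri : forall y x z, d x z <= d x y + d y z.

(* A copy of [T] that remembers the axioms, on which the instance depends. *)
Definition metric_carrier
  & (forall x, d x x = 0) & (forall x y, d x y = 0 -> x = y)
  & (forall x y, d x y = d y x) & (forall y x z, d x z <= d x y + d y z) : Type := T.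

Local Notation carrier := (metric_carrier dxx d_eq0 d_sym d_tri).

HB.instance Definition _ := Choice.on carrier.
HB.instance Definition _ := @isMetric.Build R carrier d dxx d_eq0 d_sym d_tri.

Definition metric_of : metricType R := carrier.

Lemma metric_ofE (x y : metric_of) : mdist x y = d x y.
Proof. by []. Qed.

End metric_of_distance.

Section gromov_hausdorff_bound.
Context {R : realType} (Y X : metricType R) (f : Y -> X) (theta : R).
Hypothesis theta0 : 0 < theta.
Hypothesis f_surj : forall x, exists y, f y = x.
Hypothesis f_le : forall y z, mdist (f y) (f z) <= mdist y z + theta.
Hypothesis f_ge : forall y z, mdist y z <= mdist (f y) (f z) + theta.

(** The shortest route from [y] to [x] in the disjoint union when every [z] is joined to [f z] by a
    bridge of length theta. *)
Let cross (y : Y) (x : X) : R :=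
  inf [set mdist y z + mdist (f z) x + theta | z in [set: Y]].

Let cross_has_inf y x : 
  has_inf [set mdist y z + mdist (f z) x + theta | z in [set: Y]].
Proof.
split; first by exists (mdist y y + mdist (f y) x + theta); exists y.
by exists 0 => _ [z _ <-]; rewrite !addr_ge0 ?mdist_ge0// ltW.
Qed.

Let cross_le y x z : cross y x <= mdist y z + mdist (f z) x + theta.
Proof. by apply: ge_inf; [exact: (proj2 (cross_has_inf y x))|exists z]. Qed.

Let cross_glb y x B : (forall z, B <= mdist y z + mdist (f z) x + theta) ->
  B <= cross y x.
Proof.
by move=> H; apply: lb_le_inf; [exact: (proj1 (cross_has_inf y x))|move=> _ [z _ <-]].
Qed.

Let W (a b : Y + X) : R :=
  match a, b with
  | inl y, inl z => mdist y z
  | inr x, inr w => mdist x w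
  | inl y, inr x => cross y x
  | inr x, inl y => cross y x
  end.

Let Wxx a : W a a = 0.
Proof. by case: a => x /=; rewrite mdistxx. Qed.

Let cross_gt0 y x : 0 < cross y x.
Proof.
apply: (lt_le_trans theta0); apply: cross_glb => z.
by rewrite lerDr addr_ge0 ?mdist_ge0.
Qed.

Let W_eq0 a b : W a b = 0 -> a = b.
Proof.
case: a b => [y|x] [z|w] /= E.
- by rewrite (mdist_positivity _ _ E).
- by have := cross_gt0 y w; rewrite E ltxx.
- by have := cross_gt0 z x; rewrite E ltxx.
- by rewrite (mdist_positivity _ _ E).
Qed.

Let W_sym a b : W a b = W b a.
Proof. by case: a b => [y|x] [z|w] //=; rewrite metric_sym. Qed.

Let cross_triY y z x : cross y x <= mdist y z + cross z x.
Proof.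
rewrite -lerBlDl; apply: cross_glb => u.
have := cross_le y x u; have := metric_triangle y z u; lra.
Qed.

Let cross_triX y w x : cross y x <= cross y w + mdist w x.
Proof.
rewrite -lerBlDr; apply: cross_glb => u.
have := cross_le y x u; have := metric_triangle (f u) w x; lra.
Qed.

Let cross_YXY y z x : mdist y z <= cross y x + cross z x.
Proof.
rewrite -lerBlDr; apply: cross_glb => u; rewrite lerBlDr -lerBlDl.
apply: cross_glb => v.
have := metric_triangle y u z; have := metric_triangle u v z.
have := f_ge u v; have := metric_triangle (f u) x (f v).
rewrite (metric_sym z v) (metric_sym (f v) x); have := theta0; lra.
Qed.

Let cross_XYX y x w : mdist x w <= cross y x + cross y w.
Proof.
rewrite -lerBlDr; apply: cross_glb => u; rewrite lerBlDr -lerBlDl.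
apply: cross_glb => v.
have := metric_triangle x (f u) w; have := metric_triangle (f u) (f v) w.
have := f_le u v; have := metric_triangle u y v.
rewrite (metric_sym u y) (metric_sym x (f u)); have := theta0; lra.
Qed.

Let W_tri b a c : W a c <= W a b + W b c.
Proof.
case: a b c => [y|x] [z|w] [u|v] /=.
- exact: metric_triangle.
- exact: cross_triY.
- exact: cross_YXY.
- exact: cross_triX.
- by rewrite addrC (metric_sym z u); exact: cross_triY.
- exact: cross_XYX.
- by rewrite addrC (metric_sym x w); exact: cross_triX.
- exact: metric_triangle.
Qed.

Lemma gromov_hausdorff_le : (gromov_hausdorff_dist Y X <= (2 * theta)%:E)%E.
Proof.
pose V : metricType R := metric_of Wxx W_eq0 W_sym W_tri.
pose i1 : Y -> V := fun y => inl y.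
pose i2 : X -> V := fun x => inr x.
apply: (@le_trans _ _ (hausdorff_dist (range i1) (range i2))).
  by apply: ereal_inf_lbound; exists V, i1, i2.
apply: ereal_inf_lbound; exists (2 * theta) => //.
(* The distance is at most theta; the factor 2 gives the strict inequality demanded by open
   neighborhoods. *)
have near y : cross y (f y) < 2 * theta.
  apply: le_lt_trans (cross_le y (f y) y) _; rewrite !mdistxx !add0r.
  by have := theta0; lra.
split; first by rewrite mulr_ge0// ltW.
  by move=> _ [y _ <-]; exists (i2 (f y)); [exists (f y)|exact: near].
move=> _ [x _ <-]; have [y <-] := f_surj x.
by exists (i1 y); [exists y|exact: near].
Qed.

End gromov_hausdorff_bound.

Lemma gromov_hausdorff_ge0 {R : realType} (Y X : metricType R) :
  (0 <= gromov_hausdorff_dist Y X)%E.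
Proof.
apply: le_ereal_inf_tmp => _ [W [f [h [_ _ ->]]]].
by apply: le_ereal_inf_tmp => _ [r [r0 _ _] <-]; rewrite lee_fin.
Qed.

(** * Gluing two distances at a given scale *)

Section glued_metric.
Context {R : realType} {T : Type} (d rho : T -> T -> R) (theta : R).
Hypothesis theta0 : 0 < theta.
Hypothesis dxx : forall x, d x x = 0.
Hypothesis d_ge0 : forall x y, 0 <= d x y.
Hypothesis d_sym : forall x y, d x y = d y x.
Hypothesis d_tri : forall y x z, d x z <= d x y + d y z.
Hypothesis rhoxx : forall x, rho x x = 0.
Hypothesis rho_ge0 : forall x y, 0 <= rho x y.
Hypothesis rho_sym : forall x y, rho x y = rho y x.
Hypothesis rho_tri : forall y x z, rho x z <= rho x y + rho y z.
Hypothesis d_le_rho : forall x y, d x y <= rho x y + theta.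

Let jumps x y : set R :=
  [set rho x uv.1 + d uv.1 uv.2 + theta + rho uv.2 y | uv in [set: T * T]].

Let jump x y : R := inf (jumps x y).

(* The distance [rho], shortened by at most one jump along [d] at cost [theta]. *)
Definition glued x y : R := Num.min (rho x y) (jump x y).

Let jumps_has_inf x y : has_inf (jumps x y).
Proof.
split; first by exists (rho x x + d x y + theta + rho y y); exists (x, y).
by exists 0 => _ [z _ <-]; rewrite !addr_ge0// ltW.
Qed.

Let jump_le x y u v : jump x y <= rho x u + d u v + theta + rho v y.
Proof. by apply: ge_inf; [exact: (proj2 (jumps_has_inf x y))|exists (u, v)]. Qed.

Let jump_glb x y B : (forall u v, B <= rho x u + d u v + theta + rho v y) ->
  B <= jump x y.
Proof.
move=> H; apply: lb_le_inf; first exact: (proj1 (jumps_has_inf x y)).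
by move=> _ [[u v] _ <-]; exact: H.
Qed.

Let jump_ge x y : theta <= jump x y.
Proof.
apply: jump_glb => u v; have := rho_ge0 x u; have := d_ge0 u v.
by have := rho_ge0 v y; lra.
Qed.

Lemma glued_le_rho x y : glued x y <= rho x y.
Proof. by rewrite ge_min lexx. Qed.

Lemma glued_le_d x y : glued x y <= d x y + theta.
Proof.
rewrite ge_min; apply/orP; right; have := jump_le x y x y.
by rewrite !rhoxx; lra.
Qed.

(** Each of the two rho-legs of a jump costs an error theta; one is absorbed by the toll of the
    jump, the other remains in the bound. *)
Lemma d_le_glued x y : d x y <= glued x y + theta.
Proof.
rewrite -lerBlDr le_min lerBlDr d_le_rho/=; apply: jump_glb => u v.
have := d_tri u x y; have := d_tri v u y; have := d_le_rho x u.
by have := d_le_rho v y; lra.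
Qed.

Lemma glued_small x y : glued x y < theta -> glued x y = rho x y.
Proof.
rewrite gt_min => /orP[lt|]; last by rewrite ltNge jump_ge.
by rewrite /glued min_l// (le_trans (ltW lt)) ?jump_ge.
Qed.

Lemma gluedxx x : glued x x = 0.
Proof. by rewrite /glued rhoxx min_l// (le_trans (ltW theta0) (jump_ge x x)). Qed.

Lemma glued_ge0 x y : 0 <= glued x y.
Proof. by rewrite le_min rho_ge0 (le_trans (ltW theta0) (jump_ge x y)). Qed.

Lemma glued_sym x y : glued x y = glued y x.
Proof.
rewrite /glued rho_sym; congr Num.min.
suff H a b : jump a b <= jump b a by apply/le_anti; rewrite !H.
apply: jump_glb => u v; have := jump_le a b v u.
by rewrite (rho_sym a v) (rho_sym u b) (d_sym v u); lra.
Qed.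

(** The case of two jumps is the point: they merge into a single jump from [u] to [v'], and the
    second toll theta covers the passage from rho to d between [v] and [u'], by [d_le_rho]. *)
Lemma glued_triangle y x z : glued x z <= glued x y + glued y z.
Proof.
rewrite {2}/glued {2}/glued !minEle; case: ifP => _; case: ifP => _.
- by apply: le_trans (rho_tri y x z); exact: glued_le_rho.
- rewrite -lerBlDl; apply: jump_glb => u v; rewrite lerBlDl.
  rewrite /glued ge_min; apply/orP; right; have := jump_le x z u v.
  by have := rho_tri y x u; lra.
- rewrite -lerBlDr; apply: jump_glb => u v; rewrite lerBlDr.
  rewrite /glued ge_min; apply/orP; right; have := jump_le x z u v.
  by have := rho_tri y v z; lra.
- rewrite -lerBlDr; apply: jump_glb => u v; rewrite lerBlDr -lerBlDl.
  apply: jump_glb => u' v'.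
  rewrite lerBlDl /glued ge_min; apply/orP; right; have := jump_le x z u v'.
  have := d_tri v u v'; have := d_tri u' v v'; have := d_le_rho v u'.
  by have := rho_tri y v u'; lra.
Qed.

End glued_metric.

(** * Homeomorphisms of the half-line and the new distortion function *)

Section half_line_homeomorphisms.
Context {R : realType}.
Implicit Types (eta f : R -> R) (s t : R).

(** A continuous injection of an interval is strictly monotone. A decreasing one would never reach
    [eta 0 + 1], and an increasing one reaches 0 only at 0. *)
Lemma homeo_half_lineP eta : homeo_half_line eta ->
  [/\ forall t, 0 <= t -> 0 <= eta t, eta 0 = 0,
      forall s t, 0 <= s -> s < t -> eta s < eta t &
      {within `[0, +oo[, continuous eta}].
Proof.
move=> [theta [[eta_fun theta_fun] [etaK thetaK] ceta ctheta]].
have eta_ge0 t : 0 <= t -> 0 <= eta t.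
  by move=> t0; have := eta_fun t; rewrite /= !in_itv/= !andbT => /(_ t0).
have inj : {in `[0, +oo[ &, injective eta}.
  move=> s t s0 t0 E; rewrite -(etaK s) ?inE// -(etaK t) ?inE// E//.
have surj y : 0 <= y -> exists2 t, 0 <= t & eta t = y.
  move=> y0; exists (theta y).
    by have := theta_fun y; rewrite /= !in_itv/= !andbT => /(_ y0).
  by apply: thetaK; rewrite inE/= in_itv/= y0.
have I t : 0 <= t -> t \in `[0, +oo[ by rewrite in_itv/= andbT.
have [inc|dec] := itv_continuous_inj_mono ceta inj.
  have lt s t : 0 <= s -> s < t -> eta s < eta t.
    by move=> s0 st; apply: inc => //; apply: I => //; rewrite (le_trans s0)// ltW.
  split => //; have [t t0 et] := surj 0 (lexx 0).
  have [tE|tn0] := eqVneq t 0; first by move: et; rewrite tE.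
  have tp : 0 < t by rewrite lt_neqAle eq_sym tn0.
  by have := lt 0 t (lexx 0) tp; rewrite et ltNge eta_ge0.
exfalso.
have [t t0 et] := surj (eta 0 + 1) (addr_ge0 (eta_ge0 0 (lexx 0)) ler01).
have [tE|tn0] := eqVneq t 0; first by move: et; rewrite tE; lra.
have tp : 0 < t by rewrite lt_neqAle eq_sym tn0.
by have := dec t 0 (I _ t0) (I _ (lexx 0)) tp; rewrite et; lra.
Qed.

(** The identity summand does the work: [f t >= t] gives surjectivity by intermediate values, and
    [f t - f s >= t - s] gives injectivity and a 1-Lipschitz inverse. *)
Lemma homeo_half_line_id_add (G : R -> R) : continuous G -> G 0 = 0 ->
  (forall s t, 0 <= s -> s <= t -> G s <= G t) ->
  homeo_half_line (fun t => t + G t).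
Proof.
move=> cG G0 mG.
pose f t := t + G t.
have cf : continuous f by move=> t; apply: cvgD; [exact: cvg_id|exact: cG].
have f0 : f 0 = 0 by rewrite /f G0 addr0.
have fge t : 0 <= t -> t <= f t by move=> t0; rewrite lerDl -G0; exact: mG.
have fB s t : 0 <= s -> s <= t -> t - s <= f t - f s.
  by move=> s0 st; have := mG s t s0 st; rewrite /f; lra.
have /choice[theta Ht] y : exists t, 0 <= y -> 0 <= t /\ f t = y.
  have [y0|] := leP 0 y; last by exists 0.
  have [||t] := @IVT R f 0 y y y0.
  - exact: continuous_subspaceT.
  - by rewrite f0 min_l ?max_r ?fge ?y0// (le_trans y0) ?fge.
  by rewrite in_itv/= => /andP[t0 _] E; exists t.
have thetaK y : 0 <= y -> f (theta y) = y by move=> /Ht[].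
have theta0 y : 0 <= y -> 0 <= theta y by move=> /Ht[].
have fK t : 0 <= t -> theta (f t) = t.
  move=> t0; have ft0 : 0 <= f t by rewrite (le_trans t0) ?fge.
  have := thetaK _ ft0; have u0 := theta0 _ ft0.
  have [ut|tu] := leP (theta (f t)) t.
    by have := fB _ _ u0 ut; lra.
  by have := fB _ _ t0 (ltW tu); lra.
have lip y z : 0 <= y -> 0 <= z -> `|theta y - theta z| <= `|y - z|.
  wlog yz : y z / theta z <= theta y.
    move=> H y0 z0; have [|/ltW] := leP (theta z) (theta y); first by move=> /H; apply.
    by rewrite distrC (distrC y) => /H; apply.
  move=> y0 z0; have := fB _ _ (theta0 _ z0) yz; rewrite !thetaK// => le.
  by rewrite ger0_norm ?subr_ge0// (le_trans le)// ler_norm.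
exists theta; split.
- split => t; rewrite /= !in_itv/= !andbT.
    by move=> t0; rewrite (le_trans t0) ?fge.
  exact: theta0.
- split => t; rewrite inE/= in_itv/= andbT; [exact: fK|exact: thetaK].
- exact: continuous_subspaceT.
- apply/subspace_continuousP => y; rewrite /= in_itv/= andbT => y0.
  apply/cvgrPdist_lt => e e0.
  rewrite near_withinE; near=> z => /=; rewrite in_itv/= andbT => z0.
  apply: le_lt_trans (lip _ _ y0 z0) _.
  by near: z; exact: (@cvgr_dist_lt _ _ _ _ _ id y cvg_id).
Unshelve. all: by end_near. Qed.

End half_line_homeomorphisms.

Section distortion.
Context {R : realType} (eta : R -> R).
Hypothesis eta_homeo : homeo_half_line eta.

(* The extension by 0 is continuous and monotone on the whole line. *)
Definition eta_ext (t : R) : R := eta (Num.max t 0).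

Lemma eta_extE t : 0 <= t -> eta_ext t = eta t.
Proof. by move=> t0; rewrite /eta_ext max_l. Qed.

Lemma eta_ext0 : eta_ext 0 = 0.
Proof. by have [_ e0 _ _] := homeo_half_lineP eta_homeo; rewrite eta_extE. Qed.

Lemma eta_ext_le s t : s <= t -> eta_ext s <= eta_ext t.
Proof.
have [_ _ lt _] := homeo_half_lineP eta_homeo.
move=> st; have : Num.max s 0 <= Num.max t 0 by rewrite ge_max !le_max st lexx orbT.
rewrite /eta_ext le_eqVlt => /predU1P[->//|mst]; apply/ltW/lt => //.
by rewrite le_max lexx orbT.
Qed.

Lemma eta_ext_ge0 t : 0 <= eta_ext t.
Proof.
have [ge0 _ _ _] := homeo_half_lineP eta_homeo.
by apply: ge0; rewrite le_max lexx orbT.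
Qed.

Lemma eta_ext_gt0 t : 0 < t -> 0 < eta_ext t.
Proof.
have [_ e0 lt _] := homeo_half_lineP eta_homeo.
by move=> t0; rewrite eta_extE ?ltW// -e0; exact: lt.
Qed.

Lemma continuous_eta_ext : continuous eta_ext.
Proof.
have [_ _ _ /subspace_continuousP ceta] := homeo_half_lineP eta_homeo.
move=> t; apply/cvgrPdist_lt => e e0.
have mt0 : `[0, +oo[%classic (Num.max t 0) by rewrite /= in_itv/= andbT le_max lexx orbT.
have /cvgrPdist_lt/(_ e e0) := ceta _ mt0; rewrite near_withinE => H.
have cmax : {for t, continuous (fun s : R => Num.max s 0)}.
  by apply: (@continuous_max _ _ id (cst 0)); [exact: cvg_id|exact: cst_continuous].
have H' : nbhs t [set s | `[0, +oo[%classic (Num.max s 0) ->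
    `|eta (Num.max t 0) - eta (Num.max s 0)| < e] := cmax _ H.
apply: filterS H' => s; apply.
by rewrite /= in_itv/= andbT le_max lexx orbT.
Qed.

(* One summand for each case of [quasisymmetry_estimate]. *)
Definition distortion (C t : R) : R :=
  t + C * (t + Num.sqrt t + eta_ext (4 * t) + t * eta_ext (2 * t) +
           eta_ext (2 * Num.sqrt t)).

Lemma distortion_homeo C : 0 <= C -> homeo_half_line (distortion C).
Proof.
move=> C0; apply: homeo_half_line_id_add.
- have cM (k : R) (u : R -> R) : continuous u -> continuous (fun t => eta_ext (k * u t)).
    move=> cu t; apply: (@continuous_comp _ _ _ (fun t => k * u t) eta_ext).
      by apply: cvgMl_tmp; exact: cu.
    exact: continuous_eta_ext.
  have cid : continuous (fun t : R => t) by move=> t; exact: cvg_id.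
  have cs := @sqrt_continuous R.
  move=> t; apply: cvgMl_tmp.
  have c4 : {for t, continuous (fun s : R => eta_ext (4 * s))} := cM 4 id cid t.
  have c2 : {for t, continuous (fun s : R => eta_ext (2 * s))} := cM 2 id cid t.
  have cq : {for t, continuous (fun s : R => eta_ext (2 * Num.sqrt s))} := cM 2 _ cs t.
  exact (cvgD (cvgD (cvgD (cvgD (cid t) (cs t)) c4) (cvgM (cid t) c2)) cq).
- by rewrite sqrtr0 !mulr0 eta_ext0 mul0r !addr0 mulr0.
- move=> s t s0 st; apply: ler_wpM2l => //.
  have sst : Num.sqrt s <= Num.sqrt t by rewrite ler_wsqrtr.
  apply: lerD; last by apply: eta_ext_le; rewrite ler_pM2l.
  apply: lerD; last first.
      by apply: ler_pM => //; [exact: eta_ext_ge0|apply: eta_ext_le; rewrite ler_pM2l].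
  apply: lerD; last by apply: eta_ext_le; rewrite ler_pM2l.
  exact: lerD.
Qed.

Lemma distortion_ge C c t x : 0 <= c <= C -> 0 <= t ->
  (x = t \/ x = Num.sqrt t \/ x = eta_ext (4 * t) \/ x = t * eta_ext (2 * t) \/
   x = eta_ext (2 * Num.sqrt t)) ->
  c * x <= distortion C t.
Proof.
move=> /andP[c0 cC] t0 H.
have s0 : 0 <= Num.sqrt t by rewrite sqrtr_ge0.
have h4 := eta_ext_ge0 (4 * t); have hs := eta_ext_ge0 (2 * Num.sqrt t).
have h2 : 0 <= t * eta_ext (2 * t) by rewrite mulr_ge0// eta_ext_ge0.
set y := t + Num.sqrt t + eta_ext (4 * t) + t * eta_ext (2 * t) +
  eta_ext (2 * Num.sqrt t).
have [x0 xy] : 0 <= x /\ x <= y.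
  by rewrite /y; case: H => [->|[->|[->|[->|->]]]]; split => //; lra.
have : c * x <= C * y by rewrite ler_pM.
by rewrite /distortion -/y; lra.
Qed.

End distortion.

(** * Quasisymmetry by comparison with the local unit [r] *)

Section quasisymmetry_estimate.
Context {R : realType} {T : Type} (eta : R -> R) (d D rho di : T -> T -> R)
  (r : T -> R) (theta E B : R).
Hypothesis eta_homeo : homeo_half_line eta.
Local Notation h := (eta_ext eta).
Hypothesis theta0 : 0 < theta.
Hypothesis E0 : 0 <= E.
Hypothesis B0 : 0 <= B.
Hypothesis r0 : forall x, 0 <= r x.
Hypothesis D_ge0 : forall x y, 0 <= D x y.
Hypothesis D_sym : forall x y, D x y = D y x.
Hypothesis d_gt0 : forall x y, x <> y -> 0 < d x y.
Hypothesis d_sym : forall x y, d x y = d y x.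
Hypothesis qs : forall p q s, s <> q -> D p q <= h (d p q / d q s) * D q s.
Hypothesis D_le_r : forall x y, D x y <= h (d x y / theta) * r x.
Hypothesis r_le_D : forall x y, x <> y -> r x <= h (theta / d x y) * D x y.
Hypothesis di_ge0 : forall x y, 0 <= di x y.
Hypothesis di_gt0 : forall x y, x <> y -> 0 < di x y.
Hypothesis d_le_di : forall x y, d x y <= di x y + theta.
Hypothesis di_le_d : forall x y, di x y <= d x y + theta.
Hypothesis di_le_rho : forall x y, di x y <= rho x y.
Hypothesis di_small : forall x y, di x y < theta -> di x y = rho x y.
Hypothesis di_sym : forall x y, di x y = di y x.
Hypothesis D_le_rho : forall x y, rho x y < theta ->
  D x y <= E * r x * (rho x y / theta).
Hypothesis rho_le_D : forall x y, r x * Num.min 1 (rho x y / theta) <= B * D x y.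

(** Large enough to dominate each coefficient of the case analysis below: [E * B], [E * B * 2], [B],
    1, [E * h 1] and [E]. *)
Definition distortion_cst : R := 2 * (E * B) + B + 1 + E * h 1 + E.

Lemma distortion_cst_ge0 : 0 <= distortion_cst.
Proof.
by rewrite /distortion_cst !addr_ge0// !mulr_ge0// eta_ext_ge0.
Qed.

Lemma quasisymmetry_estimate p q s : s <> q ->
  D p q <= distortion eta distortion_cst (di p q / di q s) * D q s.
Proof.
move=> sq; have qs_neq : q <> s by move=> E'; apply: sq.
pose a := di p q / theta; pose b := di q s / theta.
have b0 : 0 < b by rewrite divr_gt0// di_gt0.
have a0 : 0 <= a by rewrite divr_ge0// ltW.
have tE : di p q / di q s = a / b.
  by rewrite /a /b; field; rewrite !gt_eqF// di_gt0.
rewrite tE; set t := a / b.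
have t0 : 0 <= t by rewrite divr_ge0// ltW.
have hE := E0; have hB := B0.
have EB0 : 0 <= E * B by rewrite mulr_ge0.
have Eh0 : 0 <= E * h 1 by rewrite mulr_ge0// eta_ext_ge0.
have cs1 : 0 <= E * B <= distortion_cst by rewrite EB0 /= /distortion_cst; lra.
have cs2 : 0 <= E * h 1 <= distortion_cst by rewrite Eh0 /= /distortion_cst; lra.
have cs3 : 0 <= E <= distortion_cst by rewrite E0 /= /distortion_cst; lra.
have cs4 : 0 <= B <= distortion_cst by rewrite B0 /= /distortion_cst; lra.
have cs5 : (0 : R) <= 1 <= distortion_cst by rewrite ler01 /= /distortion_cst; lra.
have fin c x : 0 <= c <= distortion_cst ->
    (x = t \/ x = Num.sqrt t \/ x = h (4 * t) \/ x = t * h (2 * t) \/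
     x = h (2 * Num.sqrt t)) ->
    D p q <= c * x * D q s -> D p q <= distortion eta distortion_cst t * D q s.
  move=> cC Hx /le_trans; apply; apply: ler_wpM2r => //.
  exact: (distortion_ge eta_homeo cC t0 Hx).
(* The [upper] facts bound [D p q] by [r q], and the [lower] facts bound [r q] by [D q s]; chaining
   them eliminates [r q]. *)
have upper1 : a < 1 -> D p q <= E * a * r q.
  move=> a1; have small : di p q < theta by rewrite -[ltRHS]mul1r -ltr_pdivrMr.
  rewrite D_sym [E * a * r q]mulrAC /a di_sym di_small; last by rewrite di_sym.
  by apply: D_le_rho; rewrite -di_small ?(di_sym q).
have upper2 : 1 <= a -> D p q <= h (2 * a) * r q.
  move=> a1; rewrite D_sym; apply: (le_trans (D_le_r q p)); apply: ler_wpM2r => //.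
  apply: (eta_ext_le eta_homeo); rewrite ler_pdivrMr// -mulrA /a divfK ?gt_eqF//.
  have : theta <= di p q by rewrite -[leLHS]mul1r -ler_pdivlMr.
  by have := d_le_di p q; rewrite (d_sym q p); lra.
have lower1 : b < 1 -> r q <= b^-1 * B * D q s.
  move=> b1; have small : di q s < theta by rewrite -[ltRHS]mul1r -ltr_pdivrMr.
  have := rho_le_D q s; rewrite -di_small// -/b min_r ?(ltW b1)// => le.
  by rewrite -mulrA ler_pdivlMl// mulrC.
have lower2 : 1 <= b -> r q <= B * D q s.
  move=> b1; have := rho_le_D q s; rewrite min_l ?mulr1//.
  by apply: (le_trans b1); rewrite ler_pM2r ?invr_gt0.
(* From [2 * theta] on, the additive error theta is at most half of [di q s]. *)
have db : 2 <= b -> b * theta <= 2 * d q s.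
  move=> b2; rewrite /b divfK ?gt_eqF//; have := di_le_d q s.
  have : 2 * theta <= di q s by rewrite -ler_pdivlMr.
  by lra.
have lower3 : 2 <= b -> r q <= h (2 / b) * D q s.
  move=> b2; apply: (le_trans (r_le_D qs_neq)); apply: ler_wpM2r => //.
  apply: (eta_ext_le eta_homeo); rewrite ler_pdivrMr ?d_gt0//.
  by rewrite mulrAC ler_pdivlMr// mulrC db.
have at_ : a = t * b by rewrite /t divfK ?gt_eqF.
have cst1 : 0 <= E * B * 2 <= distortion_cst.
  by rewrite mulr_ge0//= /distortion_cst; lra.
have hmono := eta_ext_le eta_homeo.
have hge0 := eta_ext_ge0 eta_homeo.
have da : 1 <= a -> d p q <= 2 * a * theta.
  move=> a1; rewrite -mulrA /a divfK ?gt_eqF//.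
  have : theta <= di p q by rewrite -[leLHS]mul1r -ler_pdivlMr.
  by have := d_le_di p q; lra.
have tdef : t = a / b by [].
clearbody t; clearbody a b.
(* For [b >= 1] the range [b < 2] is split off each time, because [db] starts only at 2; there [a]
   is at most [2 * t]. *)
have [a1|a1] := ltP a 1; have [b1|b1] := ltP b 1.
- apply: (fin (E * B) t); [|by left|].
    exact: cs1.
  apply: (le_trans (upper1 a1)).
  have := ler_wpM2l (mulr_ge0 E0 a0) (lower1 b1) => /le_trans; apply.
  by rewrite le_eqVlt; apply/orP; left; apply/eqP; rewrite tdef; ring.
- have [b2|b2] := ltP b 2.
    apply: (fin (E * B * 2) t); [exact: cst1|by left|].
    apply: (le_trans (upper1 a1)).
    have := ler_wpM2l (mulr_ge0 E0 a0) (lower2 b1) => /le_trans; apply.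
    rewrite mulrA; apply: ler_wpM2r => //.
    rewrite mulrAC -!mulrA; apply: ler_wpM2l => //; apply: ler_wpM2l => //.
    by rewrite {1}at_ mulrC ler_wpM2r// ltW.
  (* The bound [E * a * h (2 / b)] must become a function of [t = a / b]. Since [t] is the product
     of [a] and [b^-1], one of these is at most [Num.sqrt t], and the other factor is bounded by a
     constant. *)
  have [as_|sa] := leP a (Num.sqrt t).
    apply: (fin (E * h 1) (Num.sqrt t)); [|by right; left|].
    exact: cs2.
    apply: (le_trans (upper1 a1)).
    have := ler_wpM2l (mulr_ge0 E0 a0) (lower3 b2) => /le_trans; apply.
    rewrite mulrA; apply: ler_wpM2r => //.
    rewrite -!mulrA; apply: ler_wpM2l => //; rewrite mulrC.
    apply: ler_pM => //.
    by apply: hmono; rewrite ler_pdivrMr// mul1r.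
  apply: (fin E (h (2 * Num.sqrt t))); [|by right; right; right; right|].
    exact: cs3.
  apply: (le_trans (upper1 a1)).
  have := ler_wpM2l (mulr_ge0 E0 a0) (lower3 b2) => /le_trans; apply.
  rewrite mulrA; apply: ler_wpM2r => //.
  rewrite -!mulrA; apply: ler_wpM2l => //.
  apply: (@le_trans _ _ (h (2 / b))); first by rewrite ler_piMl// ltW.
  apply: hmono; apply: ler_wpM2l => //.
  have bV : 0 <= b^-1 by rewrite invr_ge0 ltW.
  rewrite -(ler_pXn2r (n := 2)) ?nnegrE ?sqrtr_ge0// sqr_sqrtr// tdef expr2.
  apply: ler_wpM2r => //; rewrite leNgt; apply/negP => ab.
  have : a ^+ 2 <= t by rewrite tdef expr2 ler_wpM2l// ltW.
  rewrite -(sqr_sqrtr t0) ler_pXn2r ?nnegrE ?sqrtr_ge0// leNgt => /negP; exact.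
(* Here [a >= 1] and [b < 1], so both [b^-1] and [a] are at most [t]. *)
- apply: (fin B (t * h (2 * t))); [|by right; right; right; left|].
    exact: cs4.
  apply: (le_trans (upper2 a1)).
  have := ler_wpM2l (hge0 (2 * a)) (lower1 b1) => /le_trans; apply.
  rewrite mulrA; apply: ler_wpM2r => //.
  have bt : b^-1 <= t by rewrite tdef ler_peMl// invr_ge0 ltW.
  have at' : a <= t by rewrite at_ ler_piMr// ltW.
  rewrite mulrA mulrC; apply: ler_wpM2l => //; rewrite mulrC.
  apply: ler_pM => //; first by rewrite invr_ge0 ltW.
  by apply: hmono; rewrite ler_wpM2l.
- have [b2|b2] := ltP b 2.
    apply: (fin B (h (4 * t))); [|by right; right; left|].
    exact: cs4.
    apply: (le_trans (upper2 a1)).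
    have := ler_wpM2l (hge0 (2 * a)) (lower2 b1) => /le_trans; apply.
    rewrite mulrA; apply: ler_wpM2r => //; rewrite mulrC; apply: ler_wpM2l => //.
    apply: hmono; have : t * b <= t * 2 by rewrite ler_wpM2l// ltW.
    by rewrite -at_; lra.
  (* Both distances are large, so the quasisymmetry of the identity applies directly; passing from
     [di] to [d] costs a factor 2 on each side, whence 4. *)
  apply: (fin 1 (h (4 * t))); [|by right; right; left|].
    exact: cs5.
  rewrite mul1r; apply: (le_trans (qs p sq)); apply: ler_wpM2r => //.
  apply: hmono; rewrite ler_pdivrMr ?d_gt0//.
  apply: (le_trans (da a1)); rewrite at_.
  have := ler_wpM2l t0 (db b2); lra.
Qed.

End quasisymmetry_estimate.

(** * Points at a prescribed distance in a connected space *)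

Section metric_topology.
Context {R : realType} {X : metricType R}.
Implicit Types x y z p q : X.

Lemma mdist_continuous x : continuous (mdist x : X -> R).
Proof.
move=> y; apply/cvgrPdist_lt => e e0; apply/nbhs_ballP; exists e => // z.
rewrite ballEmdist /= => yz; rewrite ltr_norml.
have := metric_triangle x y z; have := metric_triangle x z y.
by rewrite (metric_sym z y) => ? ?; apply/andP; split; lra.
Qed.

Lemma open_mdist_lt x (e : R) : open [set y : X | mdist x y < e].
Proof.
apply: (@open_comp _ _ (mdist x : X -> R) [set t | t < e]); last exact: open_lt.
by move=> y _; exact: mdist_continuous.
Qed.

(** By the triangle inequality [p] or [q] is at distance at least theta from [x]; by connectedness
    the distances from [x] fill an interval containing 0. *)
Lemma exists_at_mdist (theta : R) (p q x : X) : connected [set: X] -> 0 < theta ->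
  2 * theta <= mdist p q -> exists y, mdist x y = theta.
Proof.
move=> cX t0 pq.
have [y yle] : exists y, theta <= mdist x y.
  have [le|lt] := leP theta (mdist x p); first by exists p.
  exists q; have := metric_triangle p x q; rewrite (metric_sym p x); lra.
have cI : connected ((mdist x : X -> R) @` [set: X]).
  apply: connected_continuous_connected => //.
  exact/continuous_subspaceT/mdist_continuous.
have iI : is_interval ((mdist x : X -> R) @` [set: X]) by exact/connected_intervalP.
have H0 : ((mdist x : X -> R) @` [set: X]) 0 by exists x => //; exact: mdistxx.
have H1 : ((mdist x : X -> R) @` [set: X]) (mdist x y) by exists y.
have [|z _ zE] := iI _ _ H0 H1 theta; last by exists z.
by rewrite (ltW t0).
Qed.

End metric_topology.

(** * The approximating space at a fixed scale *)

Section approximation_at_scale.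
Context {R : realType} {n : nat} (eta : R -> R).
Hypothesis eta_homeo : homeo_half_line eta.
Local Notation h := (eta_ext eta).
Context {X : metricType R} {S : smooth_manifold R n X} (g : riemannian_metric S).
Hypothesis cX : compact [set: X].
Hypothesis connX : connected [set: X].
Hypothesis qsX : quasisymmetric_homeo (@mdist R X) (riemannian_dist g) eta (@id X).
Local Notation d := (@mdist R X).
Local Notation D := (riemannian_dist g).
Local Notation edist := (riemannian_edist g).
Implicit Types x y z p q s : X.

Lemma qs_ext p q s : s <> q -> D p q <= h (d p q / d q s) * D q s.
Proof.
move=> sq; have [_ /(_ p q s sq)] := qsX.
by rewrite eta_extE// divr_ge0 ?mdist_ge0.
Qed.

Lemma riemannian_dist_ge0 x y : 0 <= D x y.
Proof. exact/fine_ge0/riemannian_edist_ge0. Qed.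

Lemma riemannian_dist_sym x y : D x y = D y x.
Proof. by rewrite !riemannian_distE riemannian_edist_sym. Qed.

Lemma riemannian_distxx x : D x x = 0.
Proof. by rewrite riemannian_distE riemannian_edistxx. Qed.

Lemma mdist_neq_gt0 x y : x <> y -> 0 < d x y.
Proof. by move=> /eqP xy; rewrite mdist_gt0. Qed.

(** Positivity is drawn from the hypothesis on the identity map: its inverse is continuous, so
    points at distance 0 for [D] are equal. *)
Lemma riemannian_dist_gt0 x y : x <> y -> 0 < D x y.
Proof.
move=> xy; rewrite lt_neqAle riemannian_dist_ge0 andbT; apply/eqP => D0.
have [[k [idk _ _ kc]] _] := qsX.
have [e e0 /(_ y)] := kc x _ (mdist_neq_gt0 xy).
by rewrite -D0 => /(_ e0); rewrite !idk ltxx.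
Qed.

(** Since [fine] sends an infinite value to 0, the strict positivity of [D] already excludes
    infinite distances. *)
Lemma riemannian_edist_fin x y : edist x y = (D x y)%:E.
Proof.
have [<-|/eqP xy] := eqVneq x y; first by rewrite riemannian_edistxx riemannian_distxx.
have := riemannian_dist_gt0 xy; rewrite riemannian_distE.
by case: (edist x y) => //=; rewrite ltxx.
Qed.

Lemma riemannian_dist_triangle y x z : D x z <= D x y + D y z.
Proof.
have := riemannian_edist_triangle g y x z.
by rewrite !riemannian_edist_fin -EFinD lee_fin.
Qed.

Context (theta : R).
Hypothesis theta0 : 0 < theta.
Context (t : X -> X).
Hypothesis tE : forall x, d x (t x) = theta.

Let r x := D x (t x).

Let t_neq x : t x <> x.
Proof.
move=> E; have := tE x; rewrite E mdistxx => E'.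
by move: theta0; rewrite -E' ltxx.
Qed.

Let r_gt0 x : 0 < r x.
Proof. by apply: riemannian_dist_gt0 => E; apply: (@t_neq x). Qed.

Let D_le_r x y : D x y <= h (d x y / theta) * r x.
Proof.
rewrite riemannian_dist_sym; have := qs_ext y (@t_neq x).
by rewrite tE (metric_sym y x).
Qed.

Let r_le_D x y : x <> y -> r x <= h (theta / d x y) * D x y.
Proof.
move=> xy; rewrite /r riemannian_dist_sym.
by have := @qs_ext (t x) x y (fun E => xy (esym E)); rewrite (metric_sym (t x)) tE.
Qed.

(** For [d x y <= 2 * theta] both [y] and [t y] are within [3 * theta] of [x]; each contributes
    [h 3 * r x] to the bound for [r y]. *)
Let K := 2 * h 3.
Let h_gt0 : forall s : R, 0 < s -> 0 < h s := eta_ext_gt0 eta_homeo.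

Let K_gt0 : 0 < K.
Proof. by rewrite mulr_gt0// h_gt0. Qed.

Let r_comparable x y : d x y <= 2 * theta -> r y <= K * r x.
Proof.
move=> xy; have h1 := riemannian_dist_triangle x y (t y).
apply: (le_trans h1); rewrite (riemannian_dist_sym y x).
have d1 : d x y / theta <= 3 by rewrite ler_pdivrMr//; have := theta0; lra.
have d2 : d x (t y) / theta <= 3.
  by rewrite ler_pdivrMr//; have := metric_triangle x y (t y); rewrite tE; lra.
rewrite /K -mulrA mulr_natl mulr2n; apply: lerD.
  apply: (le_trans (D_le_r x y)); apply: ler_wpM2r; first exact/ltW/r_gt0.
  exact: eta_ext_le.
apply: (le_trans (D_le_r x (t y))); apply: ler_wpM2r; first exact/ltW/r_gt0.
exact: eta_ext_le.
Qed.

(** The factor [K] makes up for the variation of [r] under averaging; the factor [h 2] is the one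
    that makes leaving the ball of radius [theta / 2] cost at least theta in rho. *)
Let A := K * h 2.
Let A_gt0 : 0 < A.
Proof. by rewrite mulr_gt0// h_gt0. Qed.

Lemma exists_conformal_metric : exists (g' : riemannian_metric S) (kappa : X -> R),
  [/\ forall gamma u, speed g' gamma u = kappa (gamma u) * speed g gamma u,
      exists C, forall y, kappa y <= C, forall y, 0 < kappa y &
      forall x y, d x y < theta ->
        h 2 * theta / r x <= kappa y <= A * K * theta / r x].
Proof.
have k0 x : 0 < A * theta / r x := divr_gt0 (mulr_gt0 A_gt0 theta0) (r_gt0 x).
have ball_refl x : [set y | d x y < theta] x by rewrite /= mdistxx.
have [kappa [sk k1 kC kb]] :=
  smooth_averaging S cX (fun x => open_mdist_lt x theta) ball_refl k0.
have [g' gE] := conformal_metric g sk k1.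
exists g', kappa; split => // x y xy; apply: kb => w wy.
(* Here [w] is a center whose averaging ball contains [y]; this explains the radius [2 * theta] in
   [r_comparable]. *)
have xw : d x w <= 2 * theta.
  by have := metric_triangle x y w; rewrite (metric_sym y w); move: xy wy => /=; lra.
have rx := r_gt0 x; have rw := r_gt0 w.
have le1 := r_comparable xw.
have le2 : r x <= K * r w by apply: r_comparable; rewrite metric_sym.
apply/andP; split.
  rewrite ler_pdivrMr// mulrAC ler_pdivlMr// /A.
  have := ler_wpM2l (ltW (mulr_gt0 (h_gt0 (ltr0n _ 2)) theta0)) le1.
  rewrite -[_ * h 2 * theta * _]mulrA; lra.
rewrite ler_pdivrMr// [leRHS]mulrAC ler_pdivlMr//.
have := ler_wpM2l (ltW (mulr_gt0 A_gt0 theta0)) le2; lra.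
Qed.

Section conformal_distance.
Context (g' : riemannian_metric S) (kappa : X -> R).
Hypothesis gE : forall gamma u, speed g' gamma u = kappa (gamma u) * speed g gamma u.
Hypothesis k_bounded : exists C, forall y, kappa y <= C.
Hypothesis k_gt0 : forall y, 0 < kappa y.
Hypothesis k_bounds : forall x y, d x y < theta ->
  h 2 * theta / r x <= kappa y <= A * K * theta / r x.
Local Notation rho := (riemannian_dist g').
Local Notation edist' := (riemannian_edist g').

Let edist'_fin x y : edist' x y = (rho x y)%:E.
Proof.
have [C kC] := k_bounded.
have C0 : 0 < C by exact: lt_le_trans (k_gt0 x) (kC x).
rewrite riemannian_distE fineK// ge0_fin_numE ?riemannian_edist_ge0//.
have le : (edist' x y <= C%:E * edist x y)%E.
  apply: (conformal_edist_le gE (B := +oo%E)) => //.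
  by rewrite riemannian_edist_fin ltry.
by apply: le_lt_trans le _; rewrite riemannian_edist_fin -EFinM ltry.
Qed.

Let rho_ge0 x y : 0 <= rho x y.
Proof. exact/fine_ge0/riemannian_edist_ge0. Qed.

Let rho_sym x y : rho x y = rho y x.
Proof. by rewrite !riemannian_distE riemannian_edist_sym. Qed.

Let rhoxx x : rho x x = 0.
Proof. by rewrite riemannian_distE riemannian_edistxx. Qed.

Let rho_tri y x z : rho x z <= rho x y + rho y z.
Proof.
by have := riemannian_edist_triangle g' y x z; rewrite !edist'_fin -EFinD lee_fin.
Qed.

Let h2_gt0 : 0 < h 2.
Proof. exact: h_gt0. Qed.

(** A curve either stays in the d-ball of radius [theta / 2], where kappa is bounded below, or
    reaches its sphere, where [D] is at least [r x / h 2]: the ratio of theta to [theta / 2] is the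
    argument 2 of [h]. *)
Let rho_ge x y :
  h 2 * theta / r x * Num.min (D x y) (r x / h 2) <= rho x y.
Proof.
have rx := r_gt0 x.
have m0 : 0 < h 2 * theta / r x by rewrite divr_gt0// mulr_gt0.
rewrite -lee_fin EFinM -(edist'_fin x y).
apply: (conformal_edist_ge gE (u := mdist x) (A := theta / 2)) => //.
- exact: mdist_continuous.
- by rewrite mdistxx divr_gt0.
- move=> z xz; suff xz' : d x z < theta by have /andP[] := k_bounds xz'.
  by apply: lt_trans xz _; rewrite ltr_pdivrMr// ltr_pMr// ltr1n.
- by rewrite riemannian_edist_fin lee_fin ge_min lexx.
- move=> z xz; rewrite riemannian_edist_fin lee_fin ge_min; apply/orP; right.
  have xz' : x <> z.
    move=> E; move: xz; rewrite E mdistxx => /esym/eqP.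
    by rewrite mulf_eq0 invr_eq0 gt_eqF//= pnatr_eq0.
  have := r_le_D xz'; rewrite xz invf_div mulrA [theta * 2]mulrC mulfK ?gt_eqF//.
  by rewrite ler_pdivrMr// mulrC.
Qed.

(** The minimum in [rho_ge] is now [r x / h 2], and the constants cancel to exactly theta. *)
Let rho_half x y : theta / 2 <= d x y -> theta <= rho x y.
Proof.
move=> xy; have rx := r_gt0 x.
have t2 : 0 < theta / 2 by rewrite divr_gt0.
have xy' : x <> y by move=> E; move: xy; rewrite E mdistxx leNgt t2.
have dxy : 0 < d x y by exact: lt_le_trans t2 xy.
apply: le_trans (rho_ge x y).
have le : r x / h 2 <= D x y.
  rewrite ler_pdivrMr// mulrC; apply: (le_trans (r_le_D xy')).
  apply: ler_wpM2r; first exact: riemannian_dist_ge0.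
  by apply: eta_ext_le => //; rewrite ler_pdivrMr//; lra.
rewrite min_r// le_eqVlt; apply/orP; left; apply/eqP.
by field; rewrite !gt_eqF.
Qed.

(** A value of rho below theta excludes the second term of the minimum in [rho_ge], whose bound
    would be theta. *)
Let D_le_rho x y : rho x y < theta -> D x y <= (h 2)^-1 * r x * (rho x y / theta).
Proof.
move=> lt; have rx := r_gt0 x.
have := rho_ge x y; have [Dle|Dgt] := leP (D x y) (r x / h 2).
  move=> le.
  have -> : D x y = (h 2)^-1 * r x / theta * (h 2 * theta / r x * D x y).
    move: (h 2) h2_gt0 (r x) rx (D x y) => a a0 b b0 c.
    by field; rewrite !gt_eqF.
  have -> : (h 2)^-1 * r x * (rho x y / theta) = (h 2)^-1 * r x / theta * rho x y.
    by move: (h 2) (r x) (rho x y) => a b c; rewrite mulrA mulrAC.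
  apply: ler_wpM2l le; rewrite divr_ge0 ?mulr_ge0 ?invr_ge0//; exact: ltW.
have -> : h 2 * theta / r x * (r x / h 2) = theta by field; rewrite !gt_eqF.
by rewrite leNgt lt.
Qed.

(** One summand for each case of the next estimate. *)
Let B := h 1 + A * K.

Let rho_le_D x y : r x * Num.min 1 (rho x y / theta) <= B * D x y.
Proof.
have rx := r_gt0 x; have Dxy := riemannian_dist_ge0 x y.
have h1 : 0 < h 1 by exact: h_gt0.
have AK : 0 < A * K by rewrite mulr_gt0.
(* The radius is chosen so that the [D]-ball of radius [r x / h 1] lies in the d-ball of radius
   theta, where kappa is bounded above. Beyond it the truncation by 1 is enough. *)
have [ge|lt] := leP (r x / h 1) (D x y).
  apply: (@le_trans _ _ (r x)).
    by rewrite ler_piMr ?ge_min ?lexx// ltW.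
  apply: (@le_trans _ _ (h 1 * D x y)).
    by rewrite mulrC -ler_pdivrMr.
  by rewrite ler_wpM2r// lerDl ltW.
have le : rho x y <= A * K * theta / r x * D x y.
  suff : (edist' x y <= (A * K * theta / r x)%:E * edist x y)%E.
    by rewrite edist'_fin riemannian_edist_fin -EFinM lee_fin.
  apply: (conformal_edist_le gE (B := (r x / h 1)%:E)).
  - by rewrite divr_gt0// mulr_gt0.
  - move=> z; rewrite riemannian_edist_fin lte_fin => xz.
    suff xz' : d x z < theta by have /andP[] := k_bounds xz'.
    rewrite ltNge; apply/negP => le.
    have dxz : 0 < d x z by exact: lt_le_trans theta0 le.
    have neq : x <> z by move=> E; move: dxz; rewrite E mdistxx ltxx.
    have : r x <= h 1 * D x z.
      apply: (le_trans (r_le_D neq)).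
      apply: ler_wpM2r; first exact: riemannian_dist_ge0.
      by apply: eta_ext_le => //; rewrite ler_pdivrMr// mul1r.
    by rewrite mulrC -ler_pdivrMr// leNgt xz.
  - by rewrite riemannian_edist_fin lte_fin.
apply: (@le_trans _ _ (r x * (rho x y / theta))).
  by rewrite ler_pM2l// ge_min lexx orbT.
apply: (@le_trans _ _ (A * K * D x y)); last by rewrite ler_wpM2r// lerDr ltW.
rewrite mulrA ler_pdivrMr// mulrC -ler_pdivlMr//.
by apply: (le_trans le); rewrite le_eqVlt; apply/orP; left; apply/eqP; ring.
Qed.

(** Induction on the number of steps: a nearly minimal curve is cut at a point [z] with
    [d x z = theta / 2]. This uses at least theta of rho, of which at most [theta / 2] is lost to
    the cut, so rho drops by at least the d-length of the step. *)
Let d_le_rho x y : d x y <= rho x y + theta.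
Proof.
have t2 : 0 < theta / 2 by rewrite divr_gt0.
have : rho x y < (Num.bound (rho x y / (theta / 2)))%:R * (theta / 2).
  by rewrite -ltr_pdivrMr// archi_boundP// divr_ge0// ltW.
move: (Num.bound _) => k; elim: k x => [|k IH] x; first by rewrite mul0r ltNge rho_ge0.
move=> lt; have [xy|xy] := ltP (d x y) (theta / 2).
  by have := rho_ge0 x y; move: theta0 t2 xy; lra.
have [|||||z xz] := @riemannian_edist_split _ _ _ _ g' (mdist x) (theta / 2) (theta / 2) x y.
- exact: mdist_continuous.
- by rewrite mdistxx.
- exact: xy.
- by rewrite edist'_fin ltry.
- exact: t2.
rewrite !edist'_fin -!EFinD lee_fin => le.
have xz2 : theta <= rho x z by apply: rho_half; rewrite xz.
have lt' : rho z y < k%:R * (theta / 2).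
  by move: lt; rewrite -natr1 mulrDl mul1r; move: theta0; lra.
have := IH z lt'; have := metric_triangle x z y; rewrite xz; lra.
Qed.

Let di := glued (d : X -> X -> R) rho theta.

Let di_eq0 x y : di x y = 0 -> x = y.
Proof.
move=> E; apply: contrapT => xy.
have small : di x y < theta by rewrite E.
have Er : rho x y = 0 by rewrite -(glued_small theta0 (@mdist_ge0 _ X) rho_ge0 small).
have := @D_le_rho x y; rewrite Er mul0r mulr0 => /(_ theta0).
by rewrite leNgt riemannian_dist_gt0.
Qed.

Let dixx x : di x x = 0.
Proof. exact: (gluedxx theta0 (@mdist_ge0 _ X) rhoxx rho_ge0). Qed.

Let di_sym x y : di x y = di y x.
Proof. exact: (glued_sym theta0 (@mdist_ge0 _ X) (@metric_sym _ X) rho_ge0 rho_sym). Qed.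

Let di_tri y x z : di x z <= di x y + di y z.
Proof.
exact: (glued_triangle theta0 (@mdist_ge0 _ X)
  (fun y x z => metric_triangle x y z) rho_ge0 rho_tri d_le_rho).
Qed.

Lemma glued_approximation : exists Y : metricType R,
  [/\ (gromov_hausdorff_dist Y X <= (2 * theta)%:E)%E,
      locally_isometric_to_riemannian Y &
      exists f : Y -> X, quasisymmetric_homeo (@mdist R Y) D
        (distortion eta (distortion_cst eta (h 2)^-1 B)) f].
Proof.
pose Y := metric_of dixx di_eq0 di_sym di_tri.
have t0 := theta0.
have di_le_d x y : di x y <= d x y + theta.
  exact: (glued_le_d theta0 (@mdist_ge0 _ X) rhoxx rho_ge0).
have d_le_di x y : d x y <= di x y + theta.
  exact: (d_le_glued theta0 (@mdist_ge0 _ X)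
    (fun y x z => metric_triangle x y z) rho_ge0 d_le_rho).
have di_le_rho x y : di x y <= rho x y by exact: glued_le_rho.
have di_small x y : di x y < theta -> di x y = rho x y.
  exact: (glued_small theta0 (@mdist_ge0 _ X) rho_ge0).
have di_ge0 x y : 0 <= di x y.
  exact: (glued_ge0 theta0 (@mdist_ge0 _ X) rho_ge0).
have di_gt0 x y : x <> y -> 0 < di x y.
  by move=> xy; rewrite lt_neqAle di_ge0 andbT; apply/eqP => /esym/di_eq0.
have B0 : 0 < B by rewrite addr_gt0 ?mulr_gt0// h_gt0.
exists Y; split.
- apply: (@gromov_hausdorff_le _ Y X (fun x => x)) => //.
  by move=> x; exists x.
- exists n, X, S, g'; split => // y.
  (* Two points of this ball are at [di]-distance below theta, where [di] equals rho. *)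
  exists [set z | di y z < theta / 2], (fun x => x).
  have t2 : 0 < theta / 2 by rewrite divr_gt0.
  have op : dist_open rho [set z | di y z < theta / 2].
    move=> p /= yp; exists (theta / 2 - di y p); first by rewrite subr_gt0.
    by move=> q pq; have := di_tri p y q; have := di_le_rho p q; move: pq; lra.
  split.
  + by rewrite /= dixx.
  + move=> p /= yp; exists (theta / 2 - di y p); first by rewrite subr_gt0.
    by move=> q pq; have := di_tri p y q; move: pq; rewrite metric_ofE; lra.
  + by rewrite image_id.
  + move=> p q /= yp yq; apply/esym/di_small.
    by have := di_tri y p q; rewrite (di_sym p y); move: yp yq; lra.
- exists (fun x => x); split.
    exists (fun x => x); split => //.
    + move=> p e e0; pose c := (h 2)^-1 * r p / theta.
      have c0 : 0 < c by rewrite divr_gt0// mulr_gt0 ?invr_gt0.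
      exists (Num.min theta (e / c)); first by rewrite lt_min theta0 divr_gt0.
      move=> q; rewrite metric_ofE lt_min => /andP[lt le].
      have lt' : rho p q < theta by rewrite -di_small.
      apply: (le_lt_trans (D_le_rho lt')).
      rewrite (_ : _ * _ = c * di p q); first by rewrite mulrC -ltr_pdivlMr.
      by rewrite di_small// /c; move: (h 2) (r p) (rho p q) => ? ? ?; rewrite mulrA mulrAC.
    (* [rho_le_D] sees rho only truncated at theta, so the target must be at most 1 in units of
       theta. *)
    + move=> p e e0; pose m := Num.min 1 (e / theta).
      have m0 : 0 < m by rewrite lt_min ltr01 divr_gt0.
      exists (r p * m / B); first by rewrite divr_gt0// mulr_gt0.
      move=> q; rewrite ltr_pdivlMr// mulrC => lt.
      have := le_lt_trans (rho_le_D p q) lt; rewrite ltr_pM2l// => lt'.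
      apply: (le_lt_trans (di_le_rho p q)).
      have : rho p q / theta < e / theta.
        have [le1|gt1] := leP 1 (rho p q / theta).
          by move: lt'; rewrite (min_l le1) lt_min ltxx.
        by move: lt'; rewrite (min_r (ltW gt1)) lt_min => /andP[].
      by rewrite ltr_pM2r// invr_gt0.
  move=> p q s sq; rewrite !metric_ofE.
  have hV0 : 0 <= (h 2)^-1 by rewrite invr_ge0 ltW.
  have qs' p' q' s' := @qs_ext p' q' s'.
  exact (quasisymmetry_estimate eta_homeo theta0 hV0 (ltW B0)
    (fun x => ltW (r_gt0 x)) riemannian_dist_ge0 riemannian_dist_sym mdist_neq_gt0
    (@metric_sym _ X) qs' D_le_r r_le_D di_ge0 di_gt0 d_le_di di_le_d
    di_le_rho di_small di_sym D_le_rho rho_le_D p sq).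
Qed.

End conformal_distance.

End approximation_at_scale.

(** * Letting the scale tend to 0 *)

Lemma gromov_hausdorff_refl {R : realType} (X : metricType R) :
  gromov_hausdorff_dist X X = 0%E.
Proof.
apply/le_anti; rewrite gromov_hausdorff_ge0 andbT; apply/lee_addgt0Pr => e e0.
have e2 : 0 < e / 2 by rewrite divr_gt0.
rewrite add0e (_ : e = 2 * (e / 2)); last by rewrite mulrC divfK.
apply: (@gromov_hausdorff_le _ X X id _ e2) => [x|y z|y z].
- by exists x.
- by rewrite lerDl ltW.
- by rewrite lerDl ltW.
Qed.

Theorem theorem1 (R : realType) (n : nat) (eta : R -> R)
    (eta_homeo : homeo_half_line eta) :
  exists eta' : R -> R,
    homeo_half_line eta' /\
    forall (X : metricType R) (S : smooth_manifold R n X)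
           (g : riemannian_metric S),
      compact [set: X] ->
      connected [set: X] ->
      quasisymmetric_homeo (@mdist R X) (riemannian_dist g) eta (@id X) ->
      exists X_ : nat -> metricType R,
        [/\ gromov_hausdorff_dist (X_ i) X @[i --> \oo] --> 0%E,
            forall i, locally_isometric_to_riemannian (X_ i) &
            forall i, exists f : X_ i -> X,
              quasisymmetric_homeo (@mdist R (X_ i)) (riemannian_dist g) eta' f].
Proof.
(* The constants of the fixed-scale construction, formed from [eta] alone before any space is
   given. *)
pose h := eta_ext eta; pose K := 2 * h 3.
pose C := distortion_cst eta (h 2)^-1 (h 1 + K * h 2 * K).
have h0 t : 0 <= h t by exact: eta_ext_ge0.
have K0 : 0 <= K by rewrite mulr_ge0.
have C0 : 0 <= C.
  by apply: distortion_cst_ge0 => //; rewrite ?invr_ge0// addr_ge0// !mulr_ge0.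
exists (distortion eta C); split; first exact: distortion_homeo.
move=> X S g cX connX qsX.
(* With at most one point no positive distance is attained and no scale is available; the constant
   sequence then works. *)
have [[p [q pq]]|trivX] := pselect (exists p q : X, p <> q); last first.
  have eqX (p q : X) : p = q.
    by apply: contrapT => pq; apply: trivX; exists p, q.
  exists (fun=> X); split.
  - under eq_fun do rewrite gromov_hausdorff_refl; exact: cvg_cst.
  - move=> _; exists n, X, S, g; split => // y.
    exists [set: X], id; split => //.
    + by move=> x _; exists 1.
    + by move=> x _; exists 1 => // z _; exists z.
    + by move=> x y' _ _; rewrite (eqX x y') riemannian_distxx mdistxx.
  - move=> _; exists id; split; first by case: qsX.
    by move=> x y z zy; case: zy; exact: eqX.
have dpq : 0 < mdist p q by exact: mdist_neq_gt0.
(* At most half of [mdist p q], as [exists_at_mdist] requires, and tending to 0. *)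
pose theta (i : nat) := mdist p q / 2 / i.+1%:R.
have theta0 i : 0 < theta i by rewrite !divr_gt0.
have theta_le i : 2 * theta i <= mdist p q.
  rewrite /theta mulrA [2 * _]mulrC divfK// ler_pdivrMr//.
  by rewrite ler_peMr ?ler1n// ltW.
have approx i : exists Y : metricType R,
    [/\ (gromov_hausdorff_dist Y X <= (2 * theta i)%:E)%E,
      locally_isometric_to_riemannian Y &
      exists f : Y -> X, quasisymmetric_homeo (@mdist R Y) (riemannian_dist g)
        (distortion eta C) f].
  have Ht (x : X) : exists y, mdist x y = theta i.
    exact: (exists_at_mdist x connX (theta0 i) (theta_le i)).
  have [t tE] := choice Ht.
  have [g' [kappa [gE kC k0 kb]]] :=
    exists_conformal_metric eta_homeo cX qsX (theta0 i) tE.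
  exact: (glued_approximation eta_homeo connX qsX (theta0 i) tE gE kC k0 kb).
have [X_ HX] := choice approx.
exists X_; split; last 2 first.
- by move=> i; case: (HX i).
- by move=> i; case: (HX i).
have theta_cvg : theta i @[i --> \oo] --> (0 : R).
  rewrite -(mulr0 (mdist p q / 2)); apply: cvgMl_tmp.
  exact: cvg_harmonic.
have upper : (2 * theta i)%:E @[i --> \oo] --> 0%E.
  apply: cvg_EFin; first by near=> i.
  by rewrite -(mulr0 2); exact: cvgMl_tmp.
apply: (squeeze_cvge _ (cvg_cst 0%E) upper); near=> i.
by rewrite gromov_hausdorff_ge0; case: (HX i).
Unshelve. all: by end_near. Qed.
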